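(* For every $y\in Y=S^1$, $$0<\dim_H\mu_y<\frac{\log3}{\log2}.$$ Furthermore, $\mu_y$ is singular with respect to every $(p_0,p_1,p_2)$-self-similar measure on $K$.
   Context: Let $q_0,q_1,q_2$ be the vertices of an equilateral triangle in $\mathbb{R}^2$, $S_i(z)=(z+q_i)/2$ for $z\in\mathbb{R}^2$, $i=0,1,2$, and let $K$ be the attractor of $\{S_0,S_1,S_2\}$ (the 2-dimensional Sierpi\'nski gasket). Let $$A_0=\begin{pmatrix}3/5&0\\0&1/5\end{pmatrix},\quad A_1=\begin{pmatrix}3/10&\sqrt3/10\\ \sqrt3/10&1/2\end{pmatrix},\quad A_2=\begin{pmatrix}3/10&-\sqrt3/10\\-\sqrt3/10&1/2\end{pmatrix}.$$ Let $\|\cdot\|$ be the Euclidean norm on $\mathbb{R}^2$, $Y=S^1=\{x\in\mathbb{R}^2:\|x\|=1\}$, and for $y\in Y$, $i=0,1,2$, let $G_i(y)=\frac53\|A_iy\|^2$ and $H_i(y)=A_iy/\|A_iy\|$; one has $\sum_iG_i(y)=1$. Let $\{\mu_y\}_{y\in Y}$ be the unique family of Borel probability measures on $K$ satisfying $\mu_y=\sum_{i=0}^2G_i(y)\,\mu_{H_i(y)}\circ S_i^{-1}$ for all $y\in Y$. For $p_i\ge 0$ with $p_0+p_1+p_2=1$, the $(p_0,p_1,p_2)$-self-similar measure is the unique Borel probability measure $\mu$ on $K$ with $\mu=\sum_ip_i\,\mu\circ S_i^{-1}$. For a Borel probability measure $\mu$ on $K$, $\dim_H\mu=\inf\{\dim_HB: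 B\text{ Borel},\ \mu(B)=1\}$. *)

(* Defs.v *)
From HB Require Import structures.
From mathcomp Require Import all_boot all_order all_algebra.
From mathcomp Require Import all_classical all_reals all_analysis.
Import Order.TTheory GRing.Theory Num.Theory.
Import numFieldNormedType.Exports.

Set Implicit Arguments.
Unset Strict Implicit.
Unset Printing Implicit Defensive.

Local Open Scope classical_set_scope.
Local Open Scope ring_scope.

(* R^2 with its Borel sigma-algebra.  The topology on matrices is that of the
   sup norm, which on R^2 is the usual topology. *)
Definition plane (R : realType) :=
  g_sigma_algebraType (@open 'cV[R]_2).

(* The library's `|x| on matrices is the sup norm, hence this definition. *)
Definition enorm (R : realType) (x : 'cV[R]_2) : R :=
  Num.sqrt (\sum_(i < 2) x i 0 ^+ 2).

(* The added 0 only matters for the empty set, whose diameter is 0. *)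
Definition ediam (R : realType) (U : set 'cV[R]_2) : \bar R :=
  ereal_sup (0%E |`
    [set d | exists x y, [/\ U x, U y & d = (enorm (x - y))%:E]]).

(* Intended for s > 0, so that empty sets in a cover contribute 0. *)
Definition hausdorff_premeasure (R : realType) (s delta : R)
    (B : set 'cV[R]_2) : \bar R :=
  ereal_inf [set t | exists U : nat -> set 'cV[R]_2,
    [/\ B `<=` \bigcup_k U k,
        (forall k, (ediam (U k) <= delta%:E)%E)
      & t = (\sum_(0 <= k <oo) (ediam (U k) `^ s))%E]].

Definition hausdorff_measure (R : realType) (s : R) (B : set 'cV[R]_2) :
    \bar R :=
  ereal_sup [set hausdorff_premeasure s delta B | delta in [set d | 0 < d]].

Definition hausdorff_dim (R : realType) (B : set 'cV[R]_2) : \bar R :=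
  ereal_inf [set s%:E | s in [set s | 0 < s /\ hausdorff_measure s B = 0%E]].

(* A Borel probability measure on a closed set K of the plane is represented by
   a Borel probability measure mu on the plane such that mu K = 1. *)
Definition measure_dim (R : realType) (K : set (plane R))
    (mu : probability (plane R) R) : \bar R :=
  ereal_inf [set hausdorff_dim B | B in
    [set B : set (plane R) | [/\ measurable B, B `<=` K & mu B = 1%E]]].

Definition singular (R : realType) (mu nu : probability (plane R) R) : Prop :=
  exists N : set (plane R),
    [/\ measurable N, mu N = 0%E & nu (~` N) = 0%E].

Definition equilateral (R : realType) (q : 'I_3 -> 'cV[R]_2) : Prop :=
  exists2 l : R, 0 < l & forall i j, i != j -> enorm (q i - q j) = l.

Definition gasket_map (R : realType) (q : 'I_3 -> 'cV[R]_2) (i : 'I_3) :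
    plane R -> plane R :=
  fun z : 'cV[R]_2 => 2^-1 *: (z + q i).

Definition attractor (R : realType) (f : 'I_3 -> 'cV[R]_2 -> 'cV[R]_2)
    (K : set 'cV[R]_2) : Prop :=
  [/\ K !=set0, compact K & K = \bigcup_i (f i @` K)].

Definition mx22 (R : realType) (a b c d : R) : 'M[R]_2 :=
  \matrix_(i, j) if i == 0 then (if j == 0 then a else b)
                 else (if j == 0 then c else d).

Definition gasket_mx (R : realType) (i : 'I_3) : 'M[R]_2 :=
  match val i with
  | 0 => mx22 (3 / 5) 0
              0       (1 / 5)
  | 1 => mx22 (3 / 10)              (Num.sqrt 3 / 10)
              (Num.sqrt 3 / 10)     (1 / 2)
  | _ => mx22 (3 / 10)              (- (Num.sqrt 3 / 10))
              (- (Num.sqrt 3 / 10)) (1 / 2)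
  end.

Definition circle (R : realType) : set 'cV[R]_2 := [set y | enorm y = 1].

Definition gasket_G (R : realType) (i : 'I_3) (y : 'cV[R]_2) : R :=
  5 / 3 * enorm (gasket_mx R i *m y) ^+ 2.

Definition gasket_H (R : realType) (i : 'I_3) (y : 'cV[R]_2) : 'cV[R]_2 :=
  (enorm (gasket_mx R i *m y))^-1 *: (gasket_mx R i *m y).

(* The index of mu ranges over R^2, but only its values on the circle are
   constrained; the circle is stable under every gasket_H i. *)
Definition gasket_family (R : realType) (q : 'I_3 -> 'cV[R]_2)
    (K : set (plane R)) (mu : 'cV[R]_2 -> probability (plane R) R) : Prop :=
  forall y, circle y ->
    mu y K = 1%E /\
    forall A : set (plane R), measurable A ->
      mu y A = (\sum_(i < 3)
        (gasket_G i y)%:E *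
          pushforward (mu (gasket_H i y)) (gasket_map q i) A)%E.

Definition self_similar (R : realType) (q : 'I_3 -> 'cV[R]_2)
    (K : set (plane R)) (p : 'I_3 -> R) (nu : probability (plane R) R) : Prop :=
  nu K = 1%E /\
  forall A : set (plane R), measurable A ->
    nu A = (\sum_(i < 3) (p i)%:E * pushforward nu (gasket_map q i) A)%E.

(* Main.v *)
Require Import Defs.
From HB Require Import structures.
From mathcomp Require Import all_boot all_order all_algebra.
From mathcomp Require Import all_classical all_reals all_analysis.
From mathcomp Require Import ring lra.
Import Order.TTheory GRing.Theory Num.Theory.
Import numFieldNormedType.Exports.
Local Open Scope classical_set_scope.
Local Open Scope ring_scope.

Set Implicit Arguments.
Unset Strict Implicit.
Unset Printing Implicit Defensive.

(* Write y = (cos t, sin t). The weight G_i(y) is affine in c_i = cos (2 t - 2 i pi / 3)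
   and H_i moves c_i to (4 + 5 c_i) / (5 + 4 c_i); hence for every y some weight
   increases by at least 8/135 when its own map H_i is applied. A fixed probability
   vector p therefore cannot match the weights at two consecutive steps, so the
   Bhattacharyya sums of sqrt (G_w(y) p_w) over words w of length 2 n are at most
   kappa^n for an absolute constant kappa < 1. Calling w heavy when p_w <= G_w(y),
   the heavy words carry all but kappa^n of the mass of mu_y and at most kappa^n of
   the p-mass. By Borel-Cantelli the limsup of the heavy cells separates mu_y from
   the p-self-similar measure (when some p_i = 0 the latter lives on an edge instead);
   with p = (1/3, 1/3, 1/3) there are at most (9 kappa)^n heavy words, so the same
   limsup set has dimension < log 3 / log 2.
   The lower bound is the mass distribution principle: a small triangle misses one
   of the three pieces at each scale, and G_i >= 1/15. *)

(** * Double-angle form of the matrices on the plane *)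

Section Circle.
Variable R : realType.
Implicit Types (y : 'cV[R]_2) (i : 'I_3).

Lemma sqr_enorm y : enorm y ^+ 2 = y 0 0 ^+ 2 + y 1 0 ^+ 2.
Proof.
rewrite /enorm sqr_sqrtr; last by apply: sumr_ge0 => i _; exact: sqr_ge0.
by rewrite !big_ord_recl big_ord0 addr0; congr (_ + y _ _ ^+ 2); exact/val_inj.
Qed.

(* With y = (cos t, sin t) this is cos (2t - 2 i pi / 3). *)
Definition gcos (i : 'I_3) (y : 'cV[R]_2) : R :=
  let u := y 0 0 ^+ 2 - y 1 0 ^+ 2 in
  let v := 2 * y 0 0 * y 1 0 in
  match val i with
  | 0 => u
  | 1 => - u / 2 + Num.sqrt 3 / 2 * v
  | _ => - u / 2 - Num.sqrt 3 / 2 * v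
  end.

Lemma mx22_mul0 (a b c d : R) y :
  (mx22 a b c d *m y) 0 0 = a * y 0 0 + b * y 1 0.
Proof.
rewrite mxE !big_ord_recl big_ord0 addr0 !mxE /=.
by congr (_ + b * y _ _); exact/val_inj.
Qed.

Lemma mx22_mul1 (a b c d : R) y :
  (mx22 a b c d *m y) 1 0 = c * y 0 0 + d * y 1 0.
Proof.
rewrite mxE !big_ord_recl big_ord0 addr0 !mxE /=.
by congr (_ + d * y _ _); exact/val_inj.
Qed.

Lemma sqr_sqrt3 : Num.sqrt 3 ^+ 2 = 3 :> R.
Proof. by rewrite sqr_sqrtr// ler0n. Qed.

(** Each matrix is symmetric with eigenvalues 3/5 and 1/5, the first along angle i pi / 3. Hence
    |A_i y|^2 is |y|^2 times 9/25 cos^2 + 1/25 sin^2 of the angle to that axis, which is affine in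
    the cosine of the double angle. *)
Lemma sqr_enorm_mul i y : enorm (gasket_mx R i *m y) ^+ 2 =
  (5 * enorm y ^+ 2 + 4 * gcos i y) / 25.
Proof.
have s3 := sqr_sqrt3.
rewrite !sqr_enorm /gcos /gasket_mx; case: i => -[|[|[|//]]] _ /=;
  rewrite mx22_mul0 mx22_mul1; by field: s3.
Qed.

Lemma gcos_mul i y : gcos i (gasket_mx R i *m y) =
  (4 * enorm y ^+ 2 + 5 * gcos i y) / 25.
Proof.
have s3 := sqr_sqrt3.
rewrite !sqr_enorm /gcos /gasket_mx; case: i => -[|[|[|//]]] _ /=;
  rewrite !mx22_mul0 !mx22_mul1; by field: s3.
Qed.

Lemma gcosZ i (k : R) y : gcos i (k *: y) = k ^+ 2 * gcos i y.
Proof. by rewrite /gcos; case: i => -[|[|[|//]]] _ /=; rewrite !mxE; field. Qed.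

Lemma sum_gcos y : \sum_(i < 3) gcos i y = 0.
Proof. by rewrite !big_ord_recl big_ord0 /gcos /=; field. Qed.

Lemma sum_sqr_gcos y : circle y -> \sum_(i < 3) gcos i y ^+ 2 = 3 / 2.
Proof.
move=> cy; have s3 := sqr_sqrt3.
have : enorm y ^+ 2 = 1 by rewrite cy expr1n.
rewrite sqr_enorm => y1.
transitivity (3 / 2 * (y 0 0 ^+ 2 + y 1 0 ^+ 2) ^+ 2); last by rewrite y1; ring.
rewrite !big_ord_recl big_ord0 /gcos /=; by field: s3.
Qed.

End Circle.

(** * The weights and their evolution under the circle maps *)

Section WeightDynamics.
Variable R : realType.
Implicit Types (y : 'cV[R]_2) (i : 'I_3).

(** With a + b + c = 0 and a^2 + b^2 + c^2 = 3/2 one gets (b - c)^2 = 3 (1 - a^2), and likewise for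
    the other two. *)
Lemma gcos_itv i y : circle y -> -1 <= gcos i y <= 1.
Proof.
move=> cy; have := sum_gcos y; have := sum_sqr_gcos cy.
rewrite !big_ord_recl !big_ord0.
set a := gcos ord0 y; set b := gcos (lift _ _) y; set c := gcos (lift _ _) y.
move=> h2 h1.
have [-> | [-> | ->]] : gcos i y = a \/ gcos i y = b \/ gcos i y = c.
- case: i => -[|[|[|//]]] ?; [left|right;left|right;right];
    by congr (gcos _ y); exact/val_inj.
- have := sqr_ge0 (b - c); move=> h; apply/andP; split; nra.
- have := sqr_ge0 (a - c); move=> h; apply/andP; split; nra.
- have := sqr_ge0 (a - b); move=> h; apply/andP; split; nra.
Qed.

Lemma gasket_GE i y : circle y -> gasket_G i y = (5 + 4 * gcos i y) / 15.
Proof.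
by move=> cy; rewrite /gasket_G sqr_enorm_mul cy expr1n; field.
Qed.

Lemma gasket_G_itv i y : circle y -> 1 / 15 <= gasket_G i y <= 3 / 5.
Proof.
by move=> cy; rewrite gasket_GE//; have /andP[? ?] := gcos_itv i cy; lra.
Qed.

Lemma sum_gasket_G y : circle y -> \sum_(i < 3) gasket_G i y = 1.
Proof.
move=> cy; under eq_bigr do rewrite gasket_GE//.
have := sum_gcos y; rewrite !big_ord_recl !big_ord0; lra.
Qed.

Lemma enorm_ge0 y : 0 <= enorm y. Proof. exact: sqrtr_ge0. Qed.

Lemma enormZ (k : R) y : 0 <= k -> enorm (k *: y) = k * enorm y.
Proof.
move=> k0; apply/eqP.
rewrite -(@eqrXn2 _ 2) ?mulr_ge0 ?enorm_ge0// exprMn !sqr_enorm !mxE.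
by apply/eqP; ring.
Qed.

Lemma enorm_mul_gt0 i y : circle y -> 0 < enorm (gasket_mx R i *m y).
Proof.
move=> cy; rewrite lt_neqAle enorm_ge0 andbT eq_sym; apply/eqP => h.
by have := gasket_G_itv i cy; rewrite /gasket_G h; lra.
Qed.

Lemma circle_H i y : circle y -> circle (gasket_H i y).
Proof.
move=> cy; have n0 := enorm_mul_gt0 i cy.
by rewrite /circle/= /gasket_H enormZ ?invr_ge0 ?enorm_ge0// mulVf// gt_eqF.
Qed.

Lemma gcos_H i y : circle y ->
  gcos i (gasket_H i y) = (4 + 5 * gcos i y) / (5 + 4 * gcos i y).
Proof.
move=> cy; have /andP[c1 _] := gcos_itv i cy.
rewrite /gasket_H gcosZ exprVn sqr_enorm_mul gcos_mul cy expr1n.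
by field; rewrite gt_eqF //=; lra.
Qed.

(* The increment is 16/15 (1 - c^2) / (5 + 4 c) with c = gcos j y, and some
   c has c^2 <= 1/2 because the three squares sum to 3/2. *)
Lemma gasket_G_H_increment y : circle y ->
  exists j, 8 / 135 <= gasket_G j (gasket_H j y) - gasket_G j y.
Proof.
move=> cy.
have [j cj] : exists j, gcos j y ^+ 2 <= 1 / 2.
  apply/not_existsP => h; have := sum_sqr_gcos cy.
  have h' j : 1 / 2 < gcos j y ^+ 2 by rewrite ltNge; apply/negP/h.
  rewrite !big_ord_recl !big_ord0.
  have := h' ord0; have := h' (lift ord0 ord0).
  by have := h' (lift ord0 (lift ord0 ord0)); lra.
exists j; rewrite !gasket_GE//; last exact: circle_H.
rewrite gcos_H//; have /andP[c1 c2] := gcos_itv j cy.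
set c := gcos j y in cj c1 c2 *.
have d0 : 0 < 5 + 4 * c by lra.
rewrite -subr_ge0.
(* Here 8/135 = (16/15) / 18, and (5 + 4 c) / 18 <= 1/2 <= 1 - c^2. *)
rewrite (_ : _ - _ = 16 / 15 * ((1 - c ^+ 2) - (5 + 4 * c) / 18) / (5 + 4 * c)).
  by apply: divr_ge0; [nra|exact: ltW].
by field; rewrite gt_eqF //=.
Qed.

End WeightDynamics.

(** * Bhattacharyya affinity over one and two steps *)

Section Affinity.
Variable R : realType.

(** Write sqrt (g p) = (g + p) / 2 - (sqrt g - sqrt p)^2 / 2. In coordinate j, where sqrt g + sqrt p
    <= 2, one has (g - p)^2 <= 4 (sqrt g - sqrt p)^2; elsewhere the arithmetic-geometric mean
    inequality suffices. *)
Lemma affinity_le (g p : 'I_3 -> R) j :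
  (forall i, 0 <= g i) -> (forall i, 0 <= p i) ->
  \sum_i g i = 1 -> \sum_i p i = 1 ->
  \sum_i Num.sqrt (g i * p i) <= 1 - (g j - p j) ^+ 2 / 8.
Proof.
move=> g0 p0 g1 p1.
have le1 (f : 'I_3 -> R) i : (forall i, 0 <= f i) -> \sum_i f i = 1 -> f i <= 1.
  by move=> f0 <-; rewrite (bigD1 i)//= lerDl sumr_ge0.
have bnd i : Num.sqrt (g i * p i) <=
    (g i + p i) / 2 - (if i == j then (g j - p j) ^+ 2 / 8 else 0).
  rewrite sqrtrM//.
  have [a2 b2] := (sqr_sqrtr (g0 i), sqr_sqrtr (p0 i)).
  have [a0 b0] := (sqrtr_ge0 (g i), sqrtr_ge0 (p i)).
  have [ga pb] := (le1 g i g0 g1, le1 p i p0 p1).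
  case: eqP => [<-|_]; last by have := sqr_ge0 (Num.sqrt (g i) - Num.sqrt (p i)); nra.
  set a := Num.sqrt (g i) in a2 a0 *; set b := Num.sqrt (p i) in b2 b0 *.
  rewrite -a2 -b2 in ga pb *.
  have a1 : a <= 1 by nra.
  have b1 : b <= 1 by nra.
  have -> : a ^+ 2 - b ^+ 2 = (a - b) * (a + b) by ring.
  rewrite exprMn.
  have : (a - b) ^+ 2 * (a + b) ^+ 2 <= (a - b) ^+ 2 * 4.
    by apply: ler_wpM2l; [exact: sqr_ge0|nra].
  nra.
apply: le_trans (ler_sum _ (fun i _ => bnd i)) _.
rewrite big_split /= -mulr_suml big_split /= g1 p1 sumrN -big_mkcond /= big_pred1_eq.
lra.
Qed.

(* Along one step of H the weights G change by at least 8/135 in some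
   coordinate, so p cannot match them twice in a row. *)
Lemma affinity2_lt1 (y : 'cV[R]_2) (p : 'I_3 -> R) : circle y ->
  (forall i, 0 <= p i) -> \sum_i p i = 1 ->
  \sum_i Num.sqrt (gasket_G i y * p i) *
    (\sum_j Num.sqrt (gasket_G j (gasket_H i y) * p j)) <= 1 - (4 / 135) ^+ 2 / 8 / 27.
Proof.
move=> cy p0 p1.
have G0 z i : circle z -> 0 <= gasket_G i z.
  by move=> cz; have := gasket_G_itv i cz; lra.
have F z j : circle z ->
    \sum_i Num.sqrt (gasket_G i z * p i) <= 1 - (gasket_G j z - p j) ^+ 2 / 8.
  by move=> cz; apply: affinity_le => //; [move=> i; exact: G0|exact: sum_gasket_G].
have F1 z : circle z -> \sum_i Num.sqrt (gasket_G i z * p i) <= 1.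
  move=> cz; apply: le_trans (F _ ord0 cz) _.
  by have := sqr_ge0 (gasket_G ord0 z - p ord0); lra.
have [j hj] := gasket_G_H_increment cy.
have cH i := circle_H i cy.
(* 4/135 is half the increment of the j-th weight, so [p j] is at least that far from one of its two
   values. *)
have [h|h] := leP (4 / 135) `|gasket_G j y - p j|.
  apply: (@le_trans _ _ (\sum_i Num.sqrt (gasket_G i y * p i))).
    by apply: ler_sum => i _; rewrite ler_piMr ?sqrtr_ge0 ?F1.
  apply: le_trans (F _ j cy) _.
  by rewrite -real_normK ?num_real//; nra.
have h2 : 4 / 135 <= `|gasket_G j (gasket_H j y) - p j|.
  move: h; rewrite ltr_norml => /andP[? ?].
  by rewrite ler_normr; apply/orP; left; lra.
(* 1/27 = 1/15 - 4/135, since the weight is at least 1/15. The branch through j, where the second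
   step loses (4/135)^2 / 8, thus enters the two-step sum with a factor of at least 1/27. *)
have pj : 1 / 27 <= p j.
  by move: h; have := gasket_G_itv j cy; rewrite ltr_norml => /andP[? ?] /andP[? ?]; lra.
have sj : 1 / 27 <= Num.sqrt (gasket_G j y * p j).
  have g1 : 1 / 27 <= gasket_G j y by have := gasket_G_itv j cy; lra.
  rewrite -[leLHS]ger0_norm ?divr_ge0// -sqrtr_sqr ler_wsqrtr// expr2.
  by apply: ler_pM; rewrite ?divr_ge0.
rewrite (bigD1 j)//=.
have := F1 _ cy; rewrite (bigD1 j)//= => Fy.
have rest : \sum_(i < 3 | i != j) Num.sqrt (gasket_G i y * p i) *
    (\sum_j Num.sqrt (gasket_G j (gasket_H i y) * p j)) <=
    \sum_(i < 3 | i != j) Num.sqrt (gasket_G i y * p i).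
  by apply: ler_sum => i _; rewrite ler_piMr ?sqrtr_ge0 ?F1.
have := F _ j (cH j).
rewrite -[X in _ - X / 8]real_normK ?num_real//.
set s := Num.sqrt _ in sj Fy *; set f := \sum_(j < 3) Num.sqrt _; move=> Fj.
have f1 : f <= 1 - (4 / 135) ^+ 2 / 8 by nra.
nra.
Qed.

End Affinity.

(** * Barycentric coordinates and the similarities *)

Section Geometry.
Variable R : realType.
Implicit Types (q : 'I_3 -> 'cV[R]_2) (x y z : 'cV[R]_2) (i j : 'I_3).

(** Gathers what the mass estimates and the separation of cells need from the triangle; [L] is a
    common Lipschitz constant of the coordinates. *)
Record barycentric q (b : 'I_3 -> 'cV[R]_2 -> R) (L : R) : Prop := {
  barycentric_map : forall i j z,
    b i (gasket_map q j z) = (b i z + (i == j)%:R) / 2 ;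
  barycentric_sum : forall z, \sum_i b i z = 1 ;
  barycentric_lip_gt0 : 0 < L ;
  barycentric_lip : forall i x y, b i x - b i y <= L * enorm (x - y) ;
  barycentric_continuous : forall i, continuous (b i) }.

Lemma ler_norm_coord x (k : 'I_2) : `|x k 0| <= enorm x.
Proof.
rewrite -sqrtr_sqr /enorm ler_wsqrtr// (bigD1 k)//= lerDl.
by apply: sumr_ge0 => i _; exact: sqr_ge0.
Qed.

Lemma affine_coord_continuous (a c d : R) :
  continuous (fun z : 'cV[R]_2 => a + c * z 0 0 + d * z 1 0).
Proof.
move=> z.
have coordM (e : R) k : (fun x : 'cV[R]_2 => e * x k 0) @ z --> e * z k 0.
  exact: cvgMl_tmp (@coord_continuous _ _ _ _ _ _).
exact: cvgD (cvgD (cvg_cst a) (coordM c 0)) (coordM d 1).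
Qed.

Lemma equilateral_barycentric q : equilateral q ->
  exists b L, barycentric q b L.
Proof.
move=> [l l0 hl].
have dist i j : i != j ->
    (q i 0 0 - q j 0 0) ^+ 2 + (q i 1 0 - q j 1 0) ^+ 2 = l ^+ 2.
  by move=> /hl <-; rewrite sqr_enorm !mxE.
(* The i-th coordinate is affine with gradient m times the sum of the q_i - q_j, which points along
   the altitude from q_i; this m gives the gradient the length 1 / altitude. *)
pose m := 2 / (3 * l ^+ 2).
have ml : m * l ^+ 2 = 2 / 3 by rewrite /m; field; rewrite gt_eqF.
pose al (k : 'I_2) i := m * \sum_j (q i k 0 - q j k 0).
pose a i := 1 - al 0 i * q i 0 0 - al 1 i * q i 1 0.
pose b i z := a i + al 0 i * z 0 0 + al 1 i * z 1 0.
pose i0 : 'I_3 := ord0; pose i1 : 'I_3 := lift ord0 ord0.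
pose i2 : 'I_3 := lift ord0 (lift ord0 ord0).
have cases i : i = i0 \/ i = i1 \/ i = i2.
  by case: i => -[|[|[|//]]] ?; [left|right;left|right;right]; apply: val_inj.
have d01 := dist i0 i1 isT; have d02 := dist i0 i2 isT.
have d12 := dist i1 i2 isT.
have alE k i : al k i = m * (3 * q i k 0 - (q i0 k 0 + q i1 k 0 + q i2 k 0)).
  by rewrite /al !big_ord_recl big_ord0 -/i0 -/i1 -/i2; ring.
have bq i j : b i (q j) = (i == j)%:R.
  rewrite /b /a !alE.
  transitivity (1 + m * ((3 * q i 0 0 - (q i0 0 0 + q i1 0 0 + q i2 0 0))
    * (q j 0 0 - q i 0 0) +
    (3 * q i 1 0 - (q i0 1 0 + q i1 1 0 + q i2 1 0)) * (q j 1 0 - q i 1 0)));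
    first by ring.
  set t := (X in 1 + m * X).
  have -> : t = ((i == j)%:R - 1) * (3 / 2 * l ^+ 2).
    rewrite /t; case: (cases i) => [->|[]->]; case: (cases j) => [->|[]->] /=;
    rewrite ?eqxx /= ?(_ : (i0 == i1) = false) ?(_ : (i0 == i2) = false)
      ?(_ : (i1 == i0) = false) ?(_ : (i1 == i2) = false)
      ?(_ : (i2 == i0) = false) ?(_ : (i2 == i1) = false) //=; lra.
  rewrite mulrCA [m * _]mulrCA ml; lra.
have bmap i j z : b i (gasket_map q j z) = (b i z + (i == j)%:R) / 2.
  by rewrite -bq /b /gasket_map !mxE; field.
have bsum z : \sum_i b i z = 1.
  rewrite !big_ord_recl big_ord0 -/i0 -/i1 -/i2 /b /a !alE.
  transitivity (3 - m * (
    ((q i0 0 0 - q i1 0 0) ^+ 2 + (q i0 1 0 - q i1 1 0) ^+ 2) +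
    ((q i0 0 0 - q i2 0 0) ^+ 2 + (q i0 1 0 - q i2 1 0) ^+ 2) +
    ((q i1 0 0 - q i2 0 0) ^+ 2 + (q i1 1 0 - q i2 1 0) ^+ 2))); first by ring.
  by rewrite d01 d02 d12 !mulrDr ml; lra.
(* The added 1 makes the Lipschitz constant positive at once. *)
exists b, (1 + \sum_i (`|al 0 i| + `|al 1 i|)); split => //.
- by apply: (lt_le_trans ltr01); rewrite lerDl sumr_ge0// => i _; rewrite addr_ge0.
- move=> i x y.
  have le_al : `|al 0 i| + `|al 1 i| <= 1 + \sum_i (`|al 0 i| + `|al 1 i|).
    rewrite (bigD1 i)//=; set s := \sum_(j < 3 | _) _.
    have s0 : 0 <= s by apply: sumr_ge0 => j _; exact: addr_ge0.
    move: (`|al 0 i|) (`|al 1 i|) => u v; lra.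
  apply: (@le_trans _ _ ((`|al 0 i| + `|al 1 i|) * enorm (x - y))); last first.
    by rewrite ler_wpM2r ?enorm_ge0.
  have -> : b i x - b i y = al 0 i * (x - y) 0 0 + al 1 i * (x - y) 1 0.
    by rewrite /b !mxE; ring.
  rewrite mulrDl; apply: lerD; apply: (le_trans (ler_norm _));
    by rewrite normrM ler_wpM2l// ler_norm_coord.
- by move=> i; exact: affine_coord_continuous.
Qed.

Lemma continuous_preimage_measurable (f : 'cV[R]_2 -> 'cV[R]_2)
    (A : set (plane R)) :
  continuous f -> measurable A -> measurable (f @^-1` A : set (plane R)).
Proof.
move=> cf mA.
have mf : measurable_fun [set: plane R] (f : plane R -> plane R).
  apply: (@measurability _ _ (plane R) (plane R) setT f (@open 'cV[R]_2)) => // _ [B oB <-].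
  by apply: sub_sigma_algebra; rewrite setTI; exact: open_comp.
by rewrite -[_ @^-1` _]setTI; exact: mf.
Qed.

Lemma gasket_map_continuous q i : continuous (gasket_map q i : 'cV[R]_2 -> 'cV[R]_2).
Proof.
move=> z.
have h : (fun x : 'cV[R]_2 => x + q i) @ z --> z + q i.
  exact: cvgD cvg_id (cvg_cst (q i)).
exact: (cvgZl_tmp h).
Qed.

Definition gasket_inv q i : 'cV[R]_2 -> 'cV[R]_2 := fun z => 2 *: z - q i.

Lemma gasket_inv_continuous q i : continuous (gasket_inv q i).
Proof.
move=> z.
have h : (fun x : 'cV[R]_2 => 2 *: x) @ z --> 2 *: z by exact: cvgZl_tmp cvg_id.
exact: cvgB h (cvg_cst (q i)).
Qed.

Lemma gasket_mapK q i : cancel (gasket_map q i) (gasket_inv q i).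
Proof. by move=> z; rewrite /gasket_inv /gasket_map scalerA divff// scale1r addrK. Qed.

Lemma gasket_invK q i : cancel (gasket_inv q i) (gasket_map q i).
Proof. by move=> z; rewrite /gasket_inv /gasket_map subrK scalerA mulVf// scale1r. Qed.

End Geometry.

(** * Words, their weights and their similarities *)

Section Words.
Variable R : realType.
Implicit Types (w v : seq 'I_3) (n : nat).

Fixpoint words n : seq (seq 'I_3) :=
  if n is n'.+1 then [seq i :: w | i <- enum 'I_3, w <- words n'] else [:: [::]].

Lemma big_words n (F : seq 'I_3 -> R) :
  \sum_(w <- words n.+1) F w = \sum_i \sum_(w <- words n) F (i :: w).
Proof. by rewrite big_allpairs_dep /= big_enum. Qed.

Lemma size_words n w : w \in words n -> size w = n.
Proof.
elim: n w => [w|n IH w /allpairsP[[i v] [_ /IH <- ->]]//].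
by rewrite inE => /eqP->.
Qed.

Lemma mem_words w : w \in words (size w).
Proof.
elim: w => // i w IH; apply/allpairsP; exists (i, w); split => //=.
by rewrite mem_enum.
Qed.

Lemma words_uniq n : uniq (words n).
Proof.
elim: n => // n IH; apply: allpairs_uniq => //; first exact: enum_uniq.
by move=> [? ?] [? ?] _ _ [-> ->].
Qed.

Section Weight.
Variables (X : Type) (dom : set X) (g : 'I_3 -> X -> R) (h : 'I_3 -> X -> X).

(** The state space is abstract so that the same lemmas serve the weights G_i moving along the
    circle and constant weights p_i, whose state space is [unit]. *)
Fixpoint weight w x : R :=
  if w is i :: w' then g i x * weight w' (h i x) else 1.

Fixpoint shift w x : X := if w is i :: w' then shift w' (h i x) else x.

Definition stochastic := forall x, dom x ->
  [/\ forall i, dom (h i x), forall i, 0 <= g i x & \sum_i g i x = 1].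

Hypothesis gh : stochastic.

Lemma shift_dom w x : dom x -> dom (shift w x).
Proof. by elim: w x => //= i w IH x /gh[dx _ _]; exact/IH/dx. Qed.

Lemma weight_ge0 w x : dom x -> 0 <= weight w x.
Proof.
by elim: w x => //= i w IH x /gh[dx g0 _]; apply: mulr_ge0; [exact: g0|exact/IH/dx].
Qed.

Lemma sum_weight n x : dom x -> \sum_(w <- words n) weight w x = 1.
Proof.
elim: n x => [|n IH] x dx; first by rewrite big_seq1.
rewrite big_words; have [dh g0 <-] := gh dx.
by apply: eq_bigr => i _; rewrite -mulr_sumr IH ?mulr1.
Qed.

End Weight.

(** The square root is multiplicative along a word, so removing the first two letters costs a factor
    [k]. Letters are removed in pairs because [k] bounds a two-step sum. *)
Lemma sum_sqrt_weight_le (X Y : Type) (dX : set X) (dY : set Y) g h g' h'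
    (k : R) n x y :
  stochastic dX g h -> stochastic dY g' h' ->
  (forall x y, dX x -> dY y -> \sum_i Num.sqrt (g i x * g' i y) *
    (\sum_j Num.sqrt (g j (h i x) * g' j (h' i y))) <= k) ->
  dX x -> dY y ->
  \sum_(w <- words n.*2)
    Num.sqrt (weight g h w x * weight g' h' w y) <= k ^+ n.
Proof.
move=> gh gh' le_k; elim: n x y => [|n IH] x y dx dy.
  by rewrite big_seq1 /= mulr1 sqrtr1 expr0.
have [dhx gx _] := gh _ dx; have [dhy gy _] := gh' _ dy.
have k0 : 0 <= k.
  apply: le_trans (le_k _ _ dx dy); apply: sumr_ge0 => i _.
  by rewrite mulr_ge0 ?sqrtr_ge0 ?sumr_ge0 // => j _; rewrite sqrtr_ge0.
rewrite doubleS big_words exprS.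
apply: (@le_trans _ _ (\sum_i \sum_j Num.sqrt (g i x * g' i y) *
   (Num.sqrt (g j (h i x) * g' j (h' i y)) * k ^+ n))).
  apply: ler_sum => i _; rewrite big_words; apply: ler_sum => j _.
  have [dhx' gx' _] := gh _ (dhx i); have [dhy' gy' _] := gh' _ (dhy i).
  rewrite mulrA; apply: le_trans (ler_wpM2l _ (IH _ _ (dhx' j) (dhy' j)));
    last by rewrite mulr_ge0 ?sqrtr_ge0.
  rewrite mulr_sumr; apply: ler_sum => w _ /=.
  rewrite -!sqrtrM ?mulr_ge0 ?gx ?gy ?gx' ?gy'//.
  by rewrite le_eqVlt; apply/orP; left; apply/eqP; congr Num.sqrt; ring.
under eq_bigr => i _.
  under eq_bigr do rewrite mulrA.
  rewrite -mulr_suml -mulr_sumr; over.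
by rewrite -mulr_suml ler_wpM2r ?exprn_ge0 ?le_k.
Qed.

Fixpoint word_map (q : 'I_3 -> 'cV[R]_2) w (z : 'cV[R]_2) : 'cV[R]_2 :=
  if w is i :: w' then gasket_map q i (word_map q w' z) else z.

Fixpoint word_inv (q : 'I_3 -> 'cV[R]_2) w (z : 'cV[R]_2) : 'cV[R]_2 :=
  if w is i :: w' then word_inv q w' (gasket_inv q i z) else z.

Lemma word_mapK q w : cancel (word_map q w) (word_inv q w).
Proof. by elim: w => //= i w IH z; rewrite gasket_mapK. Qed.

Lemma word_map_continuous q w : continuous (word_map q w).
Proof.
elim: w => /= [z|i w IH z]; first exact: cvg_id.
by apply: (@continuous_comp _ _ _ (word_map q w)); [exact: IH|exact: gasket_map_continuous].
Qed.

Lemma word_inv_continuous q w : continuous (word_inv q w).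
Proof.
elim: w => /= [z|i w IH z]; first exact: cvg_id.
by apply: (@continuous_comp _ _ _ (gasket_inv q i)); [exact: gasket_inv_continuous|exact: IH].
Qed.

Lemma enorm_word_inv q w x y :
  enorm (word_inv q w x - word_inv q w y) = 2 ^+ size w * enorm (x - y).
Proof.
elim: w x y => [|i w IH] x y /=; first by rewrite mul1r.
rewrite IH /gasket_inv opprD addrACA -opprD subrr oppr0 addr0 -scalerBr.
by rewrite enormZ// mulrA -exprSr.
Qed.

End Words.

(** * Self-similarity relations and their iteration *)

Section Transfer.
Variable R : realType.

(** Common real-valued form of the relation for the family mu and of the one for a self-similar
    measure. *)
Definition transfer (q : 'I_3 -> 'cV[R]_2) (X : Type) (dom : set X)
    (g : 'I_3 -> X -> R) (h : 'I_3 -> X -> X)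
    (P : X -> probability (plane R) R) : Prop :=
  forall x, dom x -> forall A : set (plane R), measurable A ->
    fine (P x A) = \sum_i g i x * fine (P (h i x) (gasket_map q i @^-1` A)).

Lemma probability_fineK (P : probability (plane R) R) (A : set (plane R)) :
  measurable A -> (fine (P A))%:E = P A.
Proof. by move=> mA; rewrite fineK// fin_num_measure. Qed.

Lemma gasket_family_transfer q K mu : @gasket_family R q K mu ->
  transfer q (@circle R) (@gasket_G R) (@gasket_H R) mu.
Proof.
move=> hmu y cy A mA; have [_ /(_ A mA) ->] := hmu y cy.
have mS i : measurable (gasket_map q i @^-1` A).
  by apply: continuous_preimage_measurable => //; exact: gasket_map_continuous.
rewrite /pushforward (eq_bigr (fun i => (gasket_G i y *
    fine (mu (gasket_H i y) (gasket_map q i @^-1` A)))%:E)) ?sumEFin//.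
by move=> i _; rewrite [RHS]EFinM probability_fineK.
Qed.

Lemma gasket_stochastic : stochastic (@circle R) (@gasket_G R) (@gasket_H R).
Proof.
move=> y cy; split; [by move=> i; exact: circle_H| |exact: sum_gasket_G].
by move=> i; have := gasket_G_itv i cy; lra.
Qed.

Lemma self_similar_transfer q K p nu : @self_similar R q K p nu ->
  transfer q [set: unit] (fun i _ => p i) (fun _ x => x) (fun=> nu).
Proof.
move=> [_ hnu] y cy A mA; rewrite hnu//.
have mS i : measurable (gasket_map q i @^-1` A).
  by apply: continuous_preimage_measurable => //; exact: gasket_map_continuous.
rewrite /pushforward (eq_bigr (fun i => (p i *
    fine (nu (gasket_map q i @^-1` A)))%:E)) ?sumEFin//.
by move=> i _; rewrite [RHS]EFinM probability_fineK.
Qed.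

Lemma self_similar_stochastic (p : 'I_3 -> R) :
  (forall i, 0 <= p i) -> \sum_i p i = 1 ->
  stochastic [set: unit] (fun i _ => p i) (fun _ x => x).
Proof. by []. Qed.

Section Words.
Variables (q : 'I_3 -> 'cV[R]_2) (X : Type) (dom : set X).
Variables (g : 'I_3 -> X -> R) (h : 'I_3 -> X -> X).
Variable P : X -> probability (plane R) R.
Hypothesis gh : stochastic dom g h.
Hypothesis tP : transfer q dom g h P.

Lemma transfer_words n x (A : set (plane R)) : dom x -> measurable A ->
  fine (P x A) = \sum_(w <- words n)
    weight g h w x * fine (P (shift h w x) (word_map q w @^-1` A)).
Proof.
elim: n x A => [|n IH] x A dx mA; first by rewrite big_seq1 /= mul1r.
rewrite big_words tP//; apply: eq_bigr => i _.
have [dh _ _] := gh dx.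
rewrite IH//; last first.
  by apply: continuous_preimage_measurable => //; exact: gasket_map_continuous.
by rewrite mulr_sumr; apply: eq_bigr => w _ /=; rewrite mulrA.
Qed.

End Words.
End Transfer.

(** * Measurability in the plane and support of the measures *)

Section Support.
Variable R : realType.
Implicit Types (P : probability (plane R) R) (A B : set (plane R)).

Lemma open_measurable_plane A : open (A : set 'cV[R]_2) -> measurable A.
Proof. by move=> oA; exact: sub_sigma_algebra. Qed.

Lemma closed_measurable_plane A : closed (A : set 'cV[R]_2) -> measurable A.
Proof.
move=> cA; rewrite -[A]setCK; apply: measurableC.
by apply: open_measurable_plane; exact: closed_openC.
Qed.

Lemma measurable_ge_plane (f : 'cV[R]_2 -> R) c : continuous f ->
  measurable ([set z | c <= f z] : set (plane R)).
Proof.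
move=> cf; apply: closed_measurable_plane.
by apply: (@closed_comp _ _ f [set x | c <= x]); [move=> x _; exact: cf|exact: closed_ge].
Qed.

Lemma measurable_le_plane (f : 'cV[R]_2 -> R) c : continuous f ->
  measurable ([set z | f z <= c] : set (plane R)).
Proof.
move=> cf; apply: closed_measurable_plane.
by apply: (@closed_comp _ _ f [set x | x <= c]); [move=> x _; exact: cf|exact: closed_le].
Qed.

Lemma fine_prob_le P A B : measurable A -> measurable B -> A `<=` B ->
  fine (P A) <= fine (P B).
Proof.
by move=> mA mB AB; rewrite fine_le ?fin_num_measure// le_measure ?inE.
Qed.

Lemma fine_prob_ge0 P A : 0 <= fine (P A). Proof. exact: fine_ge0. Qed.

Lemma fine_prob_le1 P A : measurable A -> fine (P A) <= 1.
Proof. by move=> mA; rewrite -lee_fin probability_fineK// probability_le1. Qed.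

Lemma fine_probC P A : measurable A -> fine (P (~` A)) = 1 - fine (P A).
Proof.
move=> mA; apply: EFin_inj.
by rewrite EFinB !probability_fineK ?probability_setC//; exact: measurableC.
Qed.

Lemma fine_prob_disjoint P A B : measurable A -> measurable B ->
  fine (P B) = 1 -> (forall z, A z -> B z -> False) -> fine (P A) = 0.
Proof.
move=> mA mB PB AB; apply/eqP; rewrite eq_le fine_prob_ge0 andbT.
rewrite -(subrr 1) -[X in _ - X]PB -fine_probC//.
by apply: fine_prob_le => //; exact: measurableC.
Qed.

Lemma attractor_compact_measurable f (K : set (plane R)) :
  attractor f K -> measurable K.
Proof.
move=> [_ cK _]; apply: closed_measurable_plane.
by apply: compact_closed => //; exact: norm_hausdorff.
Qed.

(** Let b_i attain its minimum over K at x = S_j t with t in K. Then b_i x >= b_i t / 2 >= b_i x /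
    2, so the minimum is nonnegative. *)
Lemma attractor_barycentric_ge0 q b L (K : set (plane R)) :
  barycentric q b L -> attractor (gasket_map q) K ->
  forall z i, K z -> 0 <= b i z.
Proof.
move=> hb [K0 cK KE] z i Kz.
have [x] : exists2 x : 'cV[R]_2, x \in (K : set 'cV[R]_2) &
    forall t, t \in (K : set 'cV[R]_2) -> b i x <= b i t.
  apply: compact_EVT_min => //; apply: continuous_subspaceT.
  exact: (barycentric_continuous hb).
rewrite inE => Kx xmin.
suff : 0 <= b i x by move=> /le_trans; apply; apply: xmin; rewrite inE.
move: Kx; rewrite {1}KE => -[j _ [t Kt tx]].
have := xmin t; rewrite inE => /(_ Kt).
rewrite -tx (barycentric_map hb); have : 0 <= (i == j)%:R :> R by exact: ler0n.
lra.
Qed.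

Lemma exprn_le_eq0 (r a : R) : 0 <= r < 1 -> 0 <= a ->
  (forall n, a <= r ^+ n) -> a = 0.
Proof.
move=> /andP[r0 r1] a0 h; apply/eqP; rewrite eq_le a0 andbT.
have cv : (r ^+ n) @[n --> \oo] --> (0 : R) by apply: cvg_expr; rewrite ger0_norm.
rewrite -(cvg_lim _ cv)//; apply: limr_ge; last exact: nearW.
by apply/cvg_ex; exists 0.
Qed.

End Support.

(** * Mass of small triangles *)

Section MassBound.
Variables (R : realType) (q : 'I_3 -> 'cV[R]_2) (K : set (plane R)).
Variable mu : 'cV[R]_2 -> probability (plane R) R.
Variables (b : 'I_3 -> 'cV[R]_2 -> R) (L : R).
Hypotheses (hb : barycentric q b L) (hK : attractor (gasket_map q) K).
Hypothesis hmu : gasket_family q K mu.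

Let mK : measurable K := attractor_compact_measurable hK.
Let b_ge0 := attractor_barycentric_ge0 hb hK.

Lemma gasket_family_mass y : circle y -> fine (mu y K) = 1.
Proof. by move=> cy; have [->] := hmu cy. Qed.

Let null y (A : set (plane R)) : circle y -> measurable A ->
  (forall z, A z -> (forall i, 0 <= b i z) -> False) -> fine (mu y A) = 0.
Proof.
move=> cy mA h; apply: (fine_prob_disjoint mA mK); first exact: gasket_family_mass.
by move=> z Az Kz; apply: (h z Az) => i; exact: b_ge0.
Qed.

(** The null piece i0 has weight at least 1/15, so the other two share at most 14/15. *)
Let step_le y A i0 (M : R) : circle y -> measurable A -> 0 <= M ->
  fine (mu (gasket_H i0 y) (gasket_map q i0 @^-1` A)) = 0 ->
  (forall i, i != i0 -> fine (mu (gasket_H i y) (gasket_map q i @^-1` A)) <= M) ->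
  fine (mu y A) <= 14 / 15 * M.
Proof.
move=> cy mA M0 h0 hM; rewrite (gasket_family_transfer hmu)//.
have := sum_gasket_G cy; rewrite (bigD1 i0)//= [X in _ -> X <= _](bigD1 i0)//=.
rewrite h0 mulr0 add0r => s1.
apply: (@le_trans _ _ (\sum_(i < 3 | i != i0) gasket_G i y * M)).
  apply: ler_sum => i ii0; apply: ler_wpM2l (hM _ ii0).
  by have := gasket_G_itv i cy; lra.
rewrite -mulr_suml ler_wpM2r//.
by have := gasket_G_itv i0 cy; lra.
Qed.

(** The i-th piece has b_i >= 1/2 and misses the edge b_i = 0, while the other two maps pull {b_i <=
    0} back to itself. Each step therefore gains a factor 14/15, which forces mass 0. *)
Lemma gasket_family_face0 y i : circle y ->
  fine (mu y [set z | b i z <= 0]) = 0.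
Proof.
move=> cy; have mF c := measurable_le_plane c (@barycentric_continuous _ _ _ _ hb i).
have mFm j c : measurable (gasket_map q j @^-1` [set z | b i z <= c] : set (plane R)).
  by apply: continuous_preimage_measurable; [exact: gasket_map_continuous|exact: mF].
apply: (@exprn_le_eq0 _ (14 / 15)); [lra|exact: fine_prob_ge0|].
move=> n; elim: n y cy => [|n IH] y cy; first by rewrite expr0 fine_prob_le1.
rewrite exprS; apply: (@step_le y _ i) => //.
- apply: null => //; first exact: circle_H.
  move=> z; rewrite /= (barycentric_map hb) eqxx /= => h /(_ i) h'.
  lra.
- move=> j ji; apply: le_trans (IH _ (circle_H j cy)).
  apply: fine_prob_le => //; move=> z /=.
  by rewrite (barycentric_map hb) eq_sym (negbTE ji) /= => h; lra.
Qed.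

(** When 1 - sum_i c_i is positive, this is a homothetic copy of the full triangle with that
    ratio. *)
Definition triangle (c : 'I_3 -> R) : set (plane R) :=
  [set z | forall i, c i <= b i z].

Lemma measurable_triangle c : measurable (triangle c).
Proof.
rewrite (_ : triangle c = \bigcap_(i in [set: 'I_3]) [set z | c i <= b i z]).
  apply: fin_bigcap_measurable => // i _.
  by apply: measurable_ge_plane; exact: (barycentric_continuous hb).
by apply/seteqP; split => [z h i _|z h i]; exact: h.
Qed.

Variable s : R.
Hypotheses (s0 : 0 < s) (s2 : 2 `^ s <= 15 / 14).

(* A triangle of size t < 1/4 misses one of the three pieces of the gasket,
   which costs a factor 14/15 each time the size doubles. *)
Lemma triangle_mass y c (t : R) n : circle y -> 0 < t ->
  1 - \sum_i c i = t -> 1 <= 8 * t * 2 ^+ n ->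
  fine (mu y (triangle c)) <= (8 * t) `^ s.
Proof.
have big y' c' t' : 1 <= 8 * t' -> fine (mu y' (triangle c')) <= (8 * t') `^ s.
  move=> t1; apply: (le_trans (fine_prob_le1 _ (measurable_triangle c'))).
  have p1 : 1 `^ s = 1 by rewrite powR1.
  rewrite -[leLHS]p1; apply: ge0_ler_powR => //; rewrite ?nnegrE ?ltW//; lra.
elim: n y c t => [|n IH] y c t cy t0 ct tn.
  by apply: big; rewrite expr0 mulr1 in tn.
have [t4|t4] := leP 1 (4 * t); first by apply: big; lra.
have mT i : measurable (gasket_map q i @^-1` triangle c).
  apply: continuous_preimage_measurable; first exact: gasket_map_continuous.
  exact: measurable_triangle.
(* If all c i + t were at least 1/2, summing would give t >= 1/4. On the triangle b_i <= c i + t <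
   1/2, whereas b_i >= 1/2 on the i-th piece, which is therefore the one missed. *)
have [i hi] : exists i, c i + t < 1 / 2.
  apply/not_existsP => h.
  have h' i : 1 / 2 <= c i + t by rewrite leNgt; apply/negP/h.
  move: ct; rewrite !big_ord_recl big_ord0.
  have := h' ord0; have := h' (lift ord0 ord0).
  by have := h' (lift ord0 (lift ord0 ord0)); lra.
have sub j : gasket_map q j @^-1` triangle c =
    triangle (fun k => 2 * c k - (k == j)%:R).
  apply/seteqP; split => z h k; have := h k; rewrite /= (barycentric_map hb);
    move: ((k == j)%:R) => e; lra.
have sumj j : 1 - \sum_k (2 * c k - (k == j)%:R) = 2 * t.
  have -> : \sum_k (2 * c k - (k == j)%:R) = 2 * \sum_k c k - 1.
    rewrite sumrB -mulr_sumr; congr (_ - _).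
    by rewrite (bigD1 j)//= eqxx big1 ?addr0// => k kj; rewrite (negbTE kj).
  by move: ct; lra.
apply: (@le_trans _ _ (14 / 15 * (8 * (2 * t)) `^ s)).
  apply: (@step_le y _ i) => //; first exact: measurable_triangle.
  - exact: powR_ge0.
  - apply: null => //; first exact: circle_H.
    move=> z; rewrite sub => h bz.
    have := barycentric_sum hb z; rewrite (bigD1 i)//= => bs.
    have := sumj i; rewrite (bigD1 i)//= eqxx /= => cs.
    have : \sum_(k < 3 | k != i) (2 * c k - (k == i)%:R) <= \sum_(k < 3 | k != i) b k z.
      by apply: ler_sum => k _; exact: h.
    have := bz i; move: cs bs; lra.
  - move=> j _; rewrite sub; apply: IH => //; [exact: circle_H|lra|].
    by rewrite [leRHS](_ : _ = 8 * t * 2 ^+ n.+1)// exprS; ring.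
(* Doubling the size costs 2^s <= 15/14, which the factor 14/15 absorbs. *)
have -> : 8 * (2 * t) = 2 * (8 * t) by ring.
rewrite powRM; [|lra|lra].
have := ler_wpM2r (powR_ge0 (8 * t) s) s2; lra.
Qed.

End MassBound.

(** * Lower bound for the dimension *)

Section DimensionLowerBound.
Variables (R : realType) (q : 'I_3 -> 'cV[R]_2) (K : set (plane R)).
Variable mu : 'cV[R]_2 -> probability (plane R) R.
Variables (b : 'I_3 -> 'cV[R]_2 -> R) (L : R).
Hypotheses (hb : barycentric q b L) (hK : attractor (gasket_map q) K).
Hypothesis hmu : gasket_family q K mu.

Lemma triangle_mass_ge0 s y c (t : R) : 0 < s -> 2 `^ s <= 15 / 14 ->
  circle y -> 0 <= t -> 1 - \sum_i c i = t ->
  fine (mu y (triangle b c)) <= (8 * t) `^ s.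
Proof.
move=> s0 s2 cy; rewrite le_eqVlt => /predU1P[<-|t0] ct; last first.
  have t8 : 0 < 8 * t by lra.
  apply: (triangle_mass (n := Num.bound (8 * t)^-1) hb hK hmu s0 s2 cy t0 ct).
  by rewrite mulrC -ler_pdivrMr// div1r ltW// upper_nthrootP.
rewrite mulr0 powR0 ?gt_eqF// leNgt; apply/negP.
set m := fine _ => m0.
(* For t = 0 the triangle is enlarged to size e with (8 e)^s = m / 2, contradicting its mass being
   at least m > 0. *)
pose e := (m / 2) `^ s^-1 / 8.
have e0 : 0 < e by rewrite /e divr_gt0// powR_gt0// divr_gt0.
have e8 : 0 < 8 * e by lra.
pose c' i := c i - e / 3.
have c'e : 1 - \sum_i c' i = e.
  by move: ct; rewrite /c' !big_ord_recl !big_ord0; lra.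
have : m <= (8 * e) `^ s.
  apply: (@le_trans _ _ (fine (mu y (triangle b c')))).
    apply: fine_prob_le; try exact: (measurable_triangle hb).
    by move=> z h i; apply: le_trans (h i); rewrite /c'; lra.
  apply: (triangle_mass (n := Num.bound (8 * e)^-1) hb hK hmu s0 s2 cy e0 c'e).
  by rewrite mulrC -ler_pdivrMr// div1r ltW// upper_nthrootP.
rewrite /e mulrC divfK// -powRrM mulVf ?gt_eqF// powRr1; last by rewrite divr_ge0// ltW.
by move: m0; lra.
Qed.

(** If x lies in U and U has diameter d, then b_i >= b_i x - L d on U. These bounds define a
    triangle of size 3 L d, whence the constant 24 L = 8 * 3 L. *)
Lemma diam_mass s y (U : set 'cV[R]_2) : 0 < s -> 2 `^ s <= 15 / 14 ->
  circle y -> (ediam U <= 1%:E)%E ->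
  exists T : set (plane R), [/\ measurable T, U `<=` T &
    (mu y T <= ((24 * L) `^ s)%:E * (ediam U `^ s))%E].
Proof.
move=> s0 s2 cy U1.
have d0 : (0 <= ediam U)%E by apply: ereal_sup_ubound; left.
have [->|/set0P[x Ux]] := eqVneq U set0.
  exists set0; split => //.
  by rewrite measure0 mule_ge0// ?lee_fin ?powR_ge0 ?poweR_ge0.
have fd : ediam U \is a fin_num.
  by rewrite ge0_fin_numE// (le_lt_trans U1)// ltry.
have d0' : 0 <= fine (ediam U) by exact: fine_ge0.
have L0 := barycentric_lip_gt0 hb.
pose c i := b i x - L * fine (ediam U).
exists (triangle b c); split.
- exact: (measurable_triangle hb).
- move=> z Uz i; rewrite /c lerBlDr -lerBlDl.
  apply: (le_trans (barycentric_lip hb i x z)); apply: ler_wpM2l; first exact: ltW.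
  by rewrite -lee_fin fineK//; apply: ereal_sup_ubound; right; exists x, z.
- have ct : 1 - \sum_i c i = 3 * L * fine (ediam U).
    have := barycentric_sum hb x.
    by rewrite /c !big_ord_recl !big_ord0; lra.
  rewrite -probability_fineK; last exact: (measurable_triangle hb).
  rewrite -[in leRHS](fineK fd) poweR_EFin -EFinM lee_fin -powRM//; last by lra.
  rewrite (_ : 24 * L * _ = 8 * (3 * L * fine (ediam U))); last by ring.
  by apply: triangle_mass_ge0 => //; nra.
Qed.

(** Every cover by sets of diameter at most 1 carries the whole mass 1, so its sum of diam^s is at
    least (24 L)^-s. *)
Lemma hausdorff_measure_gt0 s y (B : set (plane R)) :
  0 < s -> 2 `^ s <= 15 / 14 -> circle y ->
  measurable B -> mu y B = 1%E -> hausdorff_measure s B != 0%E.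
Proof.
move=> s0 s2 cy mB B1.
have L0 := barycentric_lip_gt0 hb.
have C0 : 0 < (24 * L) `^ s by apply: powR_gt0; lra.
have le_pre : ((((24 * L) `^ s)^-1)%:E <= hausdorff_premeasure s 1 B)%E.
  apply: le_ereal_inf_tmp => _ [U [BU dU ->]].
  have /choice[T hT] k := diam_mass s0 s2 cy (dU k).
  have : (mu y B <= \sum_(0 <= k <oo) mu y (T k))%E.
    apply: measure_sigma_subadditive => //; first by move=> k; have [] := hT k.
    by move=> z /BU[k _ Uz]; exists k => //; have [_ UT _] := hT k; exact: UT.
  rewrite B1 => le1.
  have le2 : (1 <= ((24 * L) `^ s)%:E * \sum_(0 <= k <oo) (ediam (U k) `^ s))%E.
    apply: (le_trans le1); rewrite -nneseriesZl; last by move=> k _; exact: poweR_ge0.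
    by apply: lee_nneseries => // k _; have [] := hT k.
  rewrite -[leLHS]mule1 lee_pdivrMl; [exact: le2|exact: C0].
apply/eqP => H0; have : (hausdorff_premeasure s 1 B <= hausdorff_measure s B)%E.
  by apply: ereal_sup_ubound; exists 1 => //; exact: ltr01.
rewrite H0 => /(le_trans le_pre); rewrite lee_fin leNgt invr_gt0 C0//.
Qed.

Lemma measure_dim_gt0 y : circle y -> (0 < measure_dim K (mu y))%E.
Proof.
move=> cy; have l2 : 0 < ln (2 : R) by rewrite ln_gt0// ltr1n.
(* Solves 2^s = 15/14; any smaller exponent s' has 2^s' <= 15/14, so its Hausdorff measure cannot
   vanish on a set of full mass. *)
pose s : R := ln (15 / 14) / ln 2.
have s0 : 0 < s by rewrite divr_gt0// ln_gt0//; lra.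
have s2 : 2 `^ s = 15 / 14.
  rewrite /powR pnatr_eq0 /= /s divfK ?gt_eqF// lnK// posrE; lra.
apply: (@lt_le_trans _ _ s%:E); first by rewrite lte_fin.
apply: le_ereal_inf_tmp => _ [B [mB BK B1] <-].
apply: le_ereal_inf_tmp => _ [s' [s'0 H0] <-].
rewrite lee_fin leNgt; apply/negP => lts.
have /eqP := H0; apply/negP; apply: (hausdorff_measure_gt0 s'0 _ cy mB B1).
by rewrite -s2 ler_powR ?ltW// ltr1n.
Qed.

End DimensionLowerBound.

(** * Borel-Cantelli with geometric rates *)

Section BorelCantelli.
Variable R : realType.
Variable P : probability (plane R) R.
Variable k : R.
Hypotheses (k0 : 0 < k) (k1 : k < 1).

Lemma geometric_sum_le n : \sum_(0 <= i < n) k ^+ i <= (1 - k)^-1.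
Proof.
have := @geometric_le_lim R n 1 k ler01 k0; rewrite gtr0_norm// => /(_ k1).
by rewrite mul1r /series /=; under eq_bigr do rewrite mul1r.
Qed.

Lemma nneseries_le (f : nat -> \bar R) (M : \bar R) : (forall n, 0 <= f n)%E ->
  (forall n, \sum_(0 <= i < n) f i <= M)%E -> (\sum_(0 <= i <oo) f i <= M)%E.
Proof.
move=> f0 fM; apply: lime_le; last exact: nearW.
by apply: is_cvg_nneseries => n _ _; exact: f0.
Qed.

Lemma lim_sup_null (F : nat -> set (plane R)) : (forall n, measurable (F n)) ->
  (forall n, fine (P (F n)) <= k ^+ n) -> P (lim_sup_set F) = 0%E.
Proof.
move=> mF Fk; apply: lim_sup_set_cvg0 => //.
apply: (@le_lt_trans _ _ ((1 - k)^-1)%:E); last exact: ltry.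
apply: nneseries_le => // n; apply: le_trans (_ : (\sum_(0 <= i < n) k ^+ i)%:E <= _)%E.
  rewrite -sumEFin; apply: lee_sum => i _.
  by have := Fk i; rewrite -lee_fin probability_fineK.
by rewrite lee_fin geometric_sum_le.
Qed.

(** A point outside the limsup of the F n lies in all but finitely many complements, hence in their
    limsup, which is null. *)
Lemma lim_sup_full (F : nat -> set (plane R)) : (forall n, measurable (F n)) ->
  (forall n, 1 - k ^+ n <= fine (P (F n))) -> P (~` lim_sup_set F) = 0%E.
Proof.
move=> mF Fk.
have mS (G : nat -> set (plane R)) : (forall n, measurable (G n)) ->
    measurable (lim_sup_set G).
  move=> mG; apply: bigcap_measurable => // n _.
  by apply: bigcup_measurable => m _; exact: mG.
have mC n : measurable (~` F n) by exact: measurableC.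
have C0 : P (lim_sup_set (fun n => ~` F n)) = 0%E.
  by apply: lim_sup_null => // n; rewrite fine_probC//; have := Fk n; lra.
apply/eqP; rewrite eq_le measure_ge0 andbT -C0.
apply: le_measure; rewrite ?inE; [by apply: measurableC; exact: mS|exact: mS|].
move=> z; rewrite /lim_sup_set setC_bigcap => -[n _ nz] m _.
exists (maxn n m); first by rewrite /= leq_maxr.
by move=> Fz; apply: nz; exists (maxn n m) => //=; rewrite leq_maxl.
Qed.

End BorelCantelli.

(** * Mass of unions of cells *)

Section Cells.
Variables (R : realType) (q : 'I_3 -> 'cV[R]_2).

(** The cell S_w(A) is written as the preimage of A under the inverse of S_w, so that its
    measurability follows from continuity. *)
Definition cells (W : pred (seq 'I_3)) n (A : set (plane R)) : set (plane R) :=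
  \bigcup_(w in [set w | w \in words n /\ W w]) (word_inv q w @^-1` A).

Lemma measurable_cells W n A : measurable A -> measurable (cells W n A).
Proof.
move=> mA; apply: fin_bigcup_measurable.
  by apply: (sub_finite_set _ (finite_seq (words n))) => w [].
move=> w _; apply: continuous_preimage_measurable => //.
exact: word_inv_continuous.
Qed.

Variables (X : Type) (dom : set X) (g : 'I_3 -> X -> R) (h : 'I_3 -> X -> X).
Variable P : X -> probability (plane R) R.
Hypothesis gh : stochastic dom g h.
Hypothesis tP : transfer q dom g h P.

Lemma cells_mass_ge W n A x : measurable A ->
  (forall x, dom x -> fine (P x A) = 1) -> dom x ->
  \sum_(w <- words n | W w) weight g h w x <= fine (P x (cells W n A)).
Proof.
move=> mA PA dx; have mE := measurable_cells W n mA.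
rewrite (transfer_words gh tP n dx mE) big_mkcond.
rewrite big_seq_cond [leRHS]big_seq_cond; apply: ler_sum => w.
rewrite andbT => wn.
have w0 := weight_ge0 gh w dx; have ds := shift_dom gh w dx.
case: ifP => Ww; last by rewrite mulr_ge0// fine_prob_ge0.
rewrite -[leLHS]mulr1 -(PA _ ds); apply: ler_wpM2l => //.
apply: fine_prob_le => //.
  by apply: continuous_preimage_measurable => //; exact: word_map_continuous.
by move=> z Az; exists w => //=; rewrite /= word_mapK.
Qed.

(** The third hypothesis says that cells of distinct words of equal length are disjoint. A word
    outside W then pulls the union back to a set disjoint from A, which has full mass, and so
    contributes nothing. *)
Lemma cells_mass_le W n A x : measurable A ->
  (forall x, dom x -> fine (P x A) = 1) ->
  (forall v w z, size v = size w -> A z -> A (word_inv q w (word_map q v z)) -> v = w) ->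
  dom x ->
  fine (P x (cells W n A)) <= \sum_(w <- words n | W w) weight g h w x.
Proof.
move=> mA PA sep dx; have mE := measurable_cells W n mA.
rewrite (transfer_words gh tP n dx mE) [leRHS]big_mkcond.
rewrite big_seq_cond [leRHS]big_seq_cond; apply: ler_sum => w.
rewrite andbT => wn.
have w0 := weight_ge0 gh w dx; have ds := shift_dom gh w dx.
have mw : measurable (word_map q w @^-1` cells W n A : set (plane R)).
  by apply: continuous_preimage_measurable => //; exact: word_map_continuous.
case: ifP => Ww; first by rewrite ler_piMr// fine_prob_le1.
rewrite (fine_prob_disjoint mw mA) ?mulr0//; first exact: PA.
move=> z [v [vn Wv] Av] Az; move: Ww; rewrite (sep w v z) ?Wv//.
by rewrite (size_words wn) (size_words vn).
Qed.

End Cells.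

(** Where v <= u, the geometric mean of u and v dominates v. This is the usual affinity bound on the
    error of a likelihood-ratio test. *)
Lemma sum_threshold_le (R : realType) (I : Type) (s : seq I) (u v : I -> R) :
  (forall i, 0 <= v i) ->
  \sum_(i <- s | v i <= u i) v i <= \sum_(i <- s) Num.sqrt (u i * v i).
Proof.
move=> v0; rewrite big_mkcond; apply: ler_sum => i _.
case: ifP => [vu|_]; last exact: sqrtr_ge0.
by rewrite -[leLHS]ger0_norm// -sqrtr_sqr ler_wsqrtr// expr2 ler_wpM2r.
Qed.

(** * Heavy words as a likelihood-ratio test *)

Section HeavyWords.
Variable R : realType.

Definition kappa : R := 1 - (4 / 135) ^+ 2 / 8 / 27.

Lemma kappa_gt0 : 0 < kappa. Proof. rewrite /kappa; lra. Qed.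

Lemma kappa_lt1 : kappa < 1. Proof. rewrite /kappa; lra. Qed.

Definition bernoulli_weight (p : 'I_3 -> R) w : R :=
  weight (fun i (_ : unit) => p i) (fun _ x => x) w tt.

Definition heavy (p : 'I_3 -> R) (y : 'cV[R]_2) : pred (seq 'I_3) :=
  fun w => bernoulli_weight p w <= weight (@gasket_G R) (@gasket_H R) w y.

Variables (p : 'I_3 -> R) (y : 'cV[R]_2).
Hypotheses (p0 : forall i, 0 <= p i) (p1 : \sum_i p i = 1) (cy : circle y).

Let u w := weight (@gasket_G R) (@gasket_H R) w y.
Let v := bernoulli_weight p.

Let u0 w : 0 <= u w. Proof. exact: (weight_ge0 (@gasket_stochastic R) w cy). Qed.

Let v0 w : 0 <= v w.
Proof. by apply: (weight_ge0 (self_similar_stochastic p0 p1)). Qed.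

Let aff n : \sum_(w <- words n.*2) Num.sqrt (u w * v w) <= kappa ^+ n.
Proof.
rewrite /u /v /bernoulli_weight.
apply: (@sum_sqrt_weight_le R 'cV[R]_2 unit (@circle R) [set: unit] _ _ _ _ kappa n
  y tt (@gasket_stochastic R) (self_similar_stochastic p0 p1)) => //.
by move=> z _ cz _; exact: affinity2_lt1.
Qed.

Lemma heavy_bernoulli_le n :
  \sum_(w <- words n.*2 | heavy p y w) bernoulli_weight p w <= kappa ^+ n.
Proof.
apply: le_trans (aff n); exact: (sum_threshold_le (words n.*2) u v0).
Qed.

Lemma heavy_gasket_ge n : 1 - kappa ^+ n <=
  \sum_(w <- words n.*2 | heavy p y w) weight (@gasket_G R) (@gasket_H R) w y.
Proof.
have := sum_weight (@gasket_stochastic R) n.*2 cy.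
rewrite (bigID (heavy p y)) /= => <-.
rewrite lerBlDr lerD2l; apply: le_trans (aff n).
(* On words that are not heavy u < v, so the threshold bound applies with u and v exchanged. *)
rewrite [leRHS](eq_bigr (fun w => Num.sqrt (v w * u w))); last first.
  by move=> w _; rewrite mulrC.
apply: le_trans (sum_threshold_le (words n.*2) v u0).
rewrite big_mkcond [leRHS]big_mkcond; apply: ler_sum => w _.
have := u0 w; rewrite /heavy -/(u w) -/(v w) -ltNge => uw.
by case: ifP => [/ltW->//|_]; case: ifP.
Qed.

End HeavyWords.

(** * Singularity with respect to self-similar measures *)

Section Singular.
Variables (R : realType) (q : 'I_3 -> 'cV[R]_2) (K : set (plane R)).
Variable mu : 'cV[R]_2 -> probability (plane R) R.
Variables (b : 'I_3 -> 'cV[R]_2 -> R) (L : R).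
Hypotheses (hb : barycentric q b L) (hK : attractor (gasket_map q) K).
Hypothesis hmu : gasket_family q K mu.

(** Cells of the closed triangle can share vertices; without the edges, cells of distinct words of
    equal length are disjoint, and measures not charging the edges lose no mass. *)
Definition open_triangle : set (plane R) := [set z | forall i, 0 < b i z].

Lemma fine_probI1 (P : probability (plane R) R) (A B : set (plane R)) :
  measurable A -> measurable B -> fine (P A) = 1 -> fine (P B) = 1 ->
  fine (P (A `&` B)) = 1.
Proof.
move=> mA mB PA PB; have mC := measurableC; have mI := measurableI A B mA mB.
have : fine (P (~` (A `&` B))) <= fine (P (~` A)) + fine (P (~` B)).
  rewrite -lee_fin EFinD !probability_fineK; try exact: mC.
  by rewrite setCI; apply: measureU2; exact: mC.
rewrite !fine_probC// PA PB; have := fine_prob_le1 P mI; lra.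
Qed.

Let mF i c : measurable ([set z | b i z <= c] : set (plane R)).
Proof. exact: measurable_le_plane (@barycentric_continuous _ _ _ _ hb i). Qed.

Let open_triangleE : open_triangle = ~` [set z | b ord0 z <= 0] `&`
  (~` [set z | b (lift ord0 ord0) z <= 0] `&`
   ~` [set z | b (lift ord0 (lift ord0 ord0)) z <= 0]).
Proof.
apply/seteqP; split => [z h|z /= [h0 [h1 h2]] i].
  by split; [|split] => /=; apply/negP; rewrite -ltNge; exact: h.
rewrite ltNge; apply/negP.
have [->|[->|->]] // : i = ord0 \/ i = lift ord0 ord0 \/ i = lift ord0 (lift ord0 ord0).
by case: i => -[|[|[|//]]] ?; [left|right;left|right;right]; apply: val_inj.
Qed.

Lemma measurable_open_triangle : measurable open_triangle.
Proof. by rewrite open_triangleE; do 2?[apply: measurableI]; apply: measurableC; exact: mF. Qed.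

Lemma open_triangle_mass1 (P : probability (plane R) R) :
  (forall i, fine (P [set z | b i z <= 0]) = 0) -> fine (P open_triangle) = 1.
Proof.
move=> P0; have h i : fine (P (~` [set z | b i z <= 0])) = 1.
  by rewrite fine_probC ?P0 ?subr0//; exact: mF.
have mC i : measurable (~` [set z | b i z <= 0] : set (plane R)).
  by apply: measurableC; exact: mF.
rewrite open_triangleE; apply: fine_probI1 => //; first exact: measurableI.
exact: fine_probI1.
Qed.

Lemma open_triangle_word_map w z : open_triangle z -> open_triangle (word_map q w z).
Proof.
elim: w => //= i w IH /IH h k; rewrite (barycentric_map hb).
by rewrite divr_gt0// ltr_wpDr// ler0n.
Qed.

Lemma open_triangle_word_inv w z : open_triangle (word_inv q w z) -> open_triangle z.
Proof.
elim: w z => //= i w IH z /IH h k.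
by rewrite -(gasket_invK q i z) (barycentric_map hb) divr_gt0// ltr_wpDr// ler0n.
Qed.

Lemma open_triangle_lt1 z i : open_triangle z -> b i z < 1.
Proof.
move=> h; rewrite -(barycentric_sum hb z) (bigD1 i)//= ltrDl.
have [j ji] : exists j, j != i.
  by have [->|i0] := eqVneq i ord0; [exists (lift ord0 ord0)|exists ord0; rewrite eq_sym].
rewrite (bigD1 j)//= ltr_pwDl// sumr_ge0// => k _; exact/ltW/h.
Qed.

(** At the first differing letters i and j, the same point would have b_j < 1/2 as a point of S_i
    and b_j > 1/2 as a point of S_j of the open triangle. *)
Lemma open_triangle_sep v w z : size v = size w -> open_triangle z ->
  open_triangle (word_inv q w (word_map q v z)) -> v = w.
Proof.
elim: v w z => [|i v IH] [|j w] z //= [vw] Tz.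
have [<-|ij] := eqVneq i j; first by rewrite gasket_mapK => /(IH _ _ vw Tz)->.
move=> /open_triangle_word_inv; set x := word_map q v z => Tx.
have := barycentric_map hb j j (gasket_inv q j (gasket_map q i x)).
rewrite gasket_invK (barycentric_map hb) eqxx eq_sym (negbTE ij) /= => E.
have := open_triangle_lt1 j (open_triangle_word_map v Tz); rewrite -/x => lt1.
by exfalso; have := Tx j; move: E lt1; lra.
Qed.

(** Both parts come from nu {b_i <= t} = p_i nu {b_i <= 2 t - 1} + (1 - p_i) nu {b_i <= 2 t}. At t =
    0 the first set on the right is null. *)
Lemma self_similar_face p nu i : (forall i, 0 <= p i) -> \sum_i p i = 1 ->
  self_similar q K p nu ->
  p i * fine (nu [set z | b i z <= 0]) = 0 /\
  (p i = 0 -> forall t, 0 <= t ->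
    fine (nu [set z | b i z <= t]) = fine (nu [set z | b i z <= 2 * t])).
Proof.
move=> p0 p1 hnu; have tnu := self_similar_transfer hnu.
have mK := attractor_compact_measurable hK.
have pre j t : gasket_map q j @^-1` [set z | b i z <= t] =
    [set z | b i z <= 2 * t - (i == j)%:R] :> set (plane R).
  apply/seteqP; split => z /=; rewrite (barycentric_map hb);
    move: ((i == j)%:R) => e; lra.
have split_i t : fine (nu [set z | b i z <= t]) =
    p i * fine (nu [set z | b i z <= 2 * t - 1]) +
    (1 - p i) * fine (nu [set z | b i z <= 2 * t]).
  rewrite (tnu tt I _ (mF i t)).
  rewrite (bigD1 i)//= pre eqxx /=; congr (_ + _).
  rewrite (eq_bigr (fun j => p j * fine (nu [set z | b i z <= 2 * t]))).
    rewrite -mulr_suml; congr (_ * _).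
    by move: p1; rewrite (bigD1 i)//= => <-; rewrite addrAC subrr add0r.
  by move=> j ji; rewrite pre eq_sym (negbTE ji) subr0.
split; last by move=> pi0 t t0; rewrite split_i pi0 mul0r add0r subr0 mul1r.
have := split_i 0; rewrite mulr0 sub0r.
rewrite (_ : fine (nu [set z | b i z <= -1]) = 0); first by lra.
apply: (fine_prob_disjoint (mF i (-1)) mK); first by have [->] := hnu.
by move=> z /= bz /(attractor_barycentric_ge0 hb hK i); move: bz; lra.
Qed.

Lemma gasket_family_singular y p nu : circle y ->
  (forall i, 0 <= p i) -> \sum_i p i = 1 -> self_similar q K p nu ->
  singular (mu y) nu.
Proof.
move=> cy p0 p1 hnu.
have hface i := self_similar_face i p0 p1 hnu.
(* If p_j = 0, the halving relation pushes all of nu onto the edge b_j = 0, which is null for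
   [mu y]. *)
have [[j pj]|pn0] := pselect (exists j, p j = 0).
  exists [set z | b j z <= 0]; split; first exact: mF.
    by rewrite -probability_fineK ?(gasket_family_face0 hb hK hmu)//; exact: mF.
  have full n : fine (nu [set z | b j z <= (1 / 2) ^+ n]) = 1.
    elim: n => [|n IH].
      rewrite expr0; apply/eqP; rewrite eq_le fine_prob_le1; last exact: mF.
      have mK := attractor_compact_measurable hK.
      rewrite -[leLHS](_ : fine (nu K) = 1); last by have [->] := hnu.
      apply: fine_prob_le => // z Kz.
      rewrite /= -(barycentric_sum hb z) (bigD1 j)//= lerDl sumr_ge0// => i _.
      exact: (attractor_barycentric_ge0 hb hK).
    rewrite (hface j).2 ?exprn_ge0//.
    by rewrite [2 * _](_ : _ = (1 / 2) ^+ n)// exprS; field.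
  have F0 : nu (~` lim_sup_set (fun n => [set z | b j z <= (1 / 2) ^+ n])) = 0%E.
    have h0 : 0 < 1 / 2 :> R by lra.
    have h1 : 1 / 2 < 1 :> R by lra.
    apply: (lim_sup_full h0 h1) => n; first exact: mF.
    by rewrite full lerBlDr lerDl exprn_ge0.
  apply/eqP; rewrite eq_le measure_ge0 andbT -F0.
  apply: le_measure; rewrite ?inE.
  - by apply: measurableC; exact: mF.
  - apply: measurableC; apply: bigcap_measurable => // n _.
    by apply: bigcup_measurable => m _; exact: mF.
  - move=> z bz h; apply: bz => /=.
    rewrite leNgt; apply/negP => bz.
    suff b0 : b j z = 0 by rewrite b0 ltxx in bz.
    apply: (@exprn_le_eq0 _ (1 / 2)); [lra|exact: ltW|move=> n].
    have [m /= nm bm] := h n I; apply: (le_trans bm).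
    by apply: ler_wiXn2l => //; lra.
(* With all p_i nonzero nu does not charge the edges either, so both measures live on the open
   triangle and the heavy cells separate them. *)
have pos i : p i != 0 by apply/eqP => pi0; apply: pn0; exists i.
have nu_face i : fine (nu [set z | b i z <= 0]) = 0.
  by apply/eqP; have := (hface i).1 => /eqP; rewrite mulf_eq0 (negbTE (pos i)).
have mT := measurable_open_triangle.
pose E n := cells q (heavy p y) n.*2 open_triangle.
have mE n : measurable (E n) by exact: measurable_cells.
have muT x : circle x -> fine (mu x open_triangle) = 1.
  by move=> cx; apply: open_triangle_mass1 => i; exact: (gasket_family_face0 hb hK hmu).
have nuT (x : unit) : [set: unit] x -> fine (nu open_triangle) = 1.
  by move=> _; exact: open_triangle_mass1.
exists (~` lim_sup_set E); split.
- apply: measurableC; apply: bigcap_measurable => // n _.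
  by apply: bigcup_measurable => m _; exact: mE.
- apply: (lim_sup_full (kappa_gt0 R) (kappa_lt1 R)) => // n.
  apply: le_trans (heavy_gasket_ge p0 p1 cy n) _.
  exact: (cells_mass_ge (@gasket_stochastic R) (gasket_family_transfer hmu)).
- rewrite setCK; apply: (lim_sup_null (kappa_gt0 R) (kappa_lt1 R)) => // n.
  apply: le_trans (heavy_bernoulli_le p0 p1 cy n).
  apply: (@cells_mass_le R q unit [set: unit] _ _ (fun=> nu)
    (self_similar_stochastic p0 p1) (self_similar_transfer hnu) _ _ _ tt) => //.
  exact: open_triangle_sep.
Qed.

End Singular.

(** * Covers indexed by words *)

Section WordCovers.
Variables (R : realType) (q : 'I_3 -> 'cV[R]_2) (K : set (plane R)).
Variable mu : 'cV[R]_2 -> probability (plane R) R.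
Hypotheses (hK : attractor (gasket_map q) K) (hmu : gasket_family q K mu).

Lemma attractor_diam_le : exists2 D : R, 0 < D &
  forall x y, K x -> K y -> enorm (x - y) <= D.
Proof.
have [K0 cK _] := hK.
pose f (z : 'cV[R]_2) := z 0 0 * z 0 0 + z 1 0 * z 1 0.
have cf : continuous f.
  move=> z; have c k : (fun x : 'cV[R]_2 => x k 0) @ z --> z k 0.
    exact: (@coord_continuous _ _ _ _ _ z).
  exact: cvgD (cvgM (c 0) (c 0)) (cvgM (c 1) (c 1)).
have [x0 _ x0max] : exists2 x : 'cV[R]_2, x \in (K : set 'cV[R]_2) &
    forall t, t \in (K : set 'cV[R]_2) -> f t <= f x.
  by apply: compact_EVT_max => //; exact: continuous_subspaceT.
have f0 : 0 <= f x0 by rewrite /f -!expr2 addr_ge0 ?sqr_ge0.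
(* f x0 is the largest squared norm on K and |x - y|^2 <= 2 |x|^2 + 2 |y|^2; the 1 keeps the bound
   positive. *)
exists (1 + 2 * Num.sqrt (f x0)); first by have := sqrtr_ge0 (f x0); lra.
move=> x y Kx Ky; apply: (@le_trans _ _ (2 * Num.sqrt (f x0))); last by lra.
rewrite -(@ler_pXn2r _ 2) ?nnegrE ?enorm_ge0 ?mulr_ge0 ?sqrtr_ge0//.
rewrite sqr_enorm exprMn sqr_sqrtr// !mxE.
have := x0max x; have := x0max y; rewrite !inE => /(_ Ky) + /(_ Kx).
set M := f x0; rewrite /f.
have := sqr_ge0 (x 0 0 + y 0 0); have := sqr_ge0 (x 1 0 + y 1 0).
lra.
Qed.

Lemma ediam_le (U : set 'cV[R]_2) (D : R) : 0 <= D ->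
  (forall x y, U x -> U y -> enorm (x - y) <= D) -> (ediam U <= D%:E)%E.
Proof.
move=> D0 UD; apply: ge_ereal_sup => _ [->|[x [y [Ux Uy ->]]]]; rewrite lee_fin//.
exact: UD.
Qed.

Lemma ediam_ge0 (U : set 'cV[R]_2) : (0 <= ediam U)%E.
Proof. by apply: ereal_sup_ubound; left. Qed.

Lemma ediam_set0 : ediam (set0 : set 'cV[R]_2) = 0%E.
Proof. by apply/eqP; rewrite eq_le ediam_ge0 andbT; exact: ediam_le. Qed.

Lemma sum_uniq_words (S : seq (seq 'I_3)) (f : seq 'I_3 -> R) M :
  uniq S -> (forall w, 0 <= f w) -> {in S, forall w, (size w < M)%N} ->
  \sum_(w <- S) f w <= \sum_(n < M) \sum_(w <- words n) f w.
Proof.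
move=> uS f0 SM.
rewrite [leLHS](eq_big_seq (fun w => \sum_(n < M) (if size w == n then f w else 0))).
  rewrite exchange_big; apply: ler_sum => n _ /=.
  rewrite -big_mkcond /= -big_filter.
  rewrite (perm_big [seq w <- words n | w \in S]).
    rewrite big_filter big_mkcond; apply: ler_sum => w _; by case: ifP.
  apply: uniq_perm; rewrite ?filter_uniq ?words_uniq// => w; rewrite !mem_filter.
  apply/andP/andP => -[]; last by move=> ? /size_words ->.
  by move=> /eqP <- wS; rewrite mem_words.
move=> w wS; rewrite (bigD1 (Ordinal (SM w wS)))//= eqxx big1 ?addr0// => n /negP nw.
case: eqP => // wn; case: nw; apply/eqP; exact/val_inj.
Qed.

Lemma big_pmap_option (T : Type) (h : nat -> option T) (f : T -> R) (S : seq nat) :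
  \sum_(k <- S) (if h k is Some w then f w else 0) = \sum_(w <- pmap h S) f w.
Proof.
elim: S => [|k S IH]; first by rewrite !big_nil.
by rewrite big_cons /= IH; case: (h k) => [w|] /=; rewrite ?big_cons ?add0r.
Qed.

(** Words are enumerated through their integer codes, and an integer coding no word gets the empty
    set. Codes are injective, so each partial sum runs over distinct words and is bounded by
    grouping them by length. *)
Lemma hausdorff_premeasure_le_words s delta (B : set 'cV[R]_2)
    (U : seq 'I_3 -> set 'cV[R]_2) (f : seq 'I_3 -> R) (C : R) :
  0 < s -> 0 <= delta -> (forall w, ediam (U w) <= delta%:E)%E ->
  (forall w, ediam (U w) `^ s <= (f w)%:E)%E ->
  B `<=` \bigcup_w U w ->
  (forall M, \sum_(n < M) \sum_(w <- words n) f w <= C) ->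
  (hausdorff_premeasure s delta B <= C%:E)%E.
Proof.
move=> s0 d0 Ud Uf BU fC.
have f0 w : 0 <= f w by rewrite -lee_fin; apply: le_trans (Uf w); exact: poweR_ge0.
pose V k := if pickle_inv k is Some w then U w else set0.
apply: (@le_trans _ _ (\sum_(0 <= k <oo) ediam (V k) `^ s)%E).
  apply: ereal_inf_lbound; exists V; split => //.
    move=> z /BU[w _ Uw]; exists (pickle w) => //.
    by rewrite /V pickleK_inv.
  by move=> k; rewrite /V; case: pickle_inv => [w|]; rewrite ?ediam_set0 ?lee_fin.
apply: nneseries_le => [k|N]; first exact: poweR_ge0.
apply: (@le_trans _ _
    (\sum_(0 <= k < N) (if @pickle_inv (seq 'I_3) k is Some w then f w else 0))%:E).
  rewrite -sumEFin; apply: lee_sum => k _; rewrite /V.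
  by case: pickle_inv => [w|]; rewrite ?ediam_set0 ?poweR0r ?gt_eqF.
rewrite lee_fin big_pmap_option.
set S := pmap _ _.
have uS : uniq S by apply: pmap_uniq (iota_uniq _ _); exact: pickle_invK.
apply: le_trans (fC (\max_(w <- S) (size w).+1)).
by apply: sum_uniq_words => // w wS; apply: (@leq_bigmax_seq _ _ xpredT (fun w => (size w).+1)).
Qed.

Lemma word_inv_attractor w z : K (word_inv q w z) -> K z.
Proof.
have [_ _ KE] := hK; elim: w z => //= i w IH z /IH Kz.
by rewrite KE; exists i => //; exists (gasket_inv q i z) => //; rewrite gasket_invK.
Qed.

End WordCovers.

(** * Upper bound for the dimension *)

Section DimensionUpperBound.
Variables (R : realType) (q : 'I_3 -> 'cV[R]_2) (K : set (plane R)).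
Variable mu : 'cV[R]_2 -> probability (plane R) R.
Hypotheses (hK : attractor (gasket_map q) K) (hmu : gasket_family q K mu).

Lemma geometric_small (a t e : R) : 0 <= t < 1 -> 0 < e ->
  exists N, forall n, (N <= n)%N -> a * t ^+ n <= e.
Proof.
move=> /andP[t0 t1] e0.
have : geometric a t @ \oo --> (0 : R) by apply: cvg_geometric; rewrite ger0_norm.
move=> /cvgrPdist_le /(_ e e0) [N _ hN]; exists N => n Nn.
have := hN n Nn; rewrite sub0r normrN /geometric /=.
by move=> /(le_trans (ler_norm _)).
Qed.

Lemma sum_even_le (g : nat -> R) M : (forall n, 0 <= g n) ->
  (forall n, odd n -> g n = 0) -> \sum_(n < M) g n <= \sum_(n < M) g n.*2.
Proof.
move=> g0 g1; apply: (@le_trans _ _ (\sum_(n < M.*2) g n)).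
  rewrite -!(big_mkord xpredT g) (@big_cat_nat _ _ _ M 0 M.*2)//=; last first.
    by rewrite -addnn leq_addr.
  by rewrite lerDl sumr_ge0.
elim: M => [|M IH]; first by rewrite !big_ord0.
rewrite doubleS !big_ord_recr/= (g1 M.*2.+1) ?addr0 ?lerD2r//.
by rewrite /= odd_double.
Qed.

Lemma bernoulli_weight_const (a : R) w :
  bernoulli_weight (fun=> a) w = a ^+ size w.
Proof. by rewrite /bernoulli_weight; elim: w => //= i w ->; rewrite exprS. Qed.

(* Since sum_w v(w) <= kappa^n over the heavy words of length 2 n, where
   v(w) = 9^-n, there are at most (9 kappa)^n of them. *)
Lemma measure_dim_lt y : circle y ->
  (measure_dim K (mu y) < (ln 3 / ln 2)%:E)%E.
Proof.
move=> cy; have [k0 k1] := (kappa_gt0 R, kappa_lt1 R).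
pose r := Num.sqrt (kappa R); pose t := Num.sqrt r.
have r0 : 0 < r by rewrite sqrtr_gt0.
have r2 : r ^+ 2 = kappa R by rewrite sqr_sqrtr// ltW.
have t0 : 0 < t by rewrite sqrtr_gt0.
have t2 : t ^+ 2 = r by rewrite sqr_sqrtr// ltW.
have r1 : r < 1 by nra.
have t1 : t < 1 by nra.
have r9 : 1 < 9 * r by have : 1 / 4 < kappa R; [rewrite /kappa; lra|nra].
have l2 : 0 < ln (2 : R) by rewrite ln_gt0// ltr1n.
(* This is 4^s = 9 r with r = sqrt kappa. At most (9 kappa)^n cells of size about 4^-n then
   contribute a multiple of (9 kappa)^n / (9 r)^n = r^n, which is summable, while r < 1 keeps s
   below log 3 / log 2. *)
pose s := ln (9 * r) / (2 * ln 2).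
have s0 : 0 < s by rewrite divr_gt0 ?ln_gt0// mulr_gt0.
have s3 : s < ln 3 / ln 2.
  have e9 : ln (9 : R) = 2 * ln 3.
    have -> : 9 = 3 * 3 :> R by ring.
    by rewrite lnM ?posrE//; ring.
  have : ln (9 * r) < ln 9 by rewrite ltr_ln ?posrE//; lra.
  rewrite e9 /s ltr_pdivrMr ?mulr_gt0// (_ : _ * (2 * _) = 2 * ln 3)//.
  by field; rewrite gt_eqF.
apply: (@le_lt_trans _ _ s%:E); last by rewrite lte_fin.
have mK := attractor_compact_measurable hK.
have [D D0 KD] := attractor_diam_le hK.
pose p (_ : 'I_3) : R := 1 / 3.
have p0 i : 0 <= p i by rewrite /p; lra.
have p1 : \sum_i p i = 1 by rewrite !big_ord_recl big_ord0 /p; lra.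
pose W := heavy p y.
pose E n := cells q W n.*2 K.
have mE n : measurable (E n) by exact: measurable_cells.
have EK n : E n `<=` K by move=> z [w _ /(word_inv_attractor hK)].
have mB : measurable (lim_sup_set E).
  by apply: bigcap_measurable => // n _; apply: bigcup_measurable => m _; exact: mE.
have B1 : mu y (lim_sup_set E) = 1%E.
  have : fine (mu y (~` lim_sup_set E)) = 0.
    rewrite (lim_sup_full k0 k1)// => n.
    apply: le_trans (heavy_gasket_ge p0 p1 cy n) _.
    apply: (cells_mass_ge (@gasket_stochastic R) (gasket_family_transfer hmu)) => //.
    exact: (gasket_family_mass hmu).
  rewrite fine_probC// => /eqP; rewrite subr_eq0 => /eqP B1.
  by rewrite -probability_fineK// -B1.
have BK : lim_sup_set E `<=` K by move=> z /(_ 0%N I)[n _ /EK].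
apply: (@le_trans _ _ (hausdorff_dim (lim_sup_set E))).
  by apply: ereal_inf_lbound; exists (lim_sup_set E).
apply: ereal_inf_lbound; exists s => //; split => //.
pose a : R := 2^-1 `^ s.
have a0 : 0 < a by rewrite powR_gt0 ?invr_gt0.
have a2 : a ^+ 2 = (9 * r)^-1.
  rewrite -powR_mulrn ?ltW// /a -powRrM /powR invr_eq0 pnatr_eq0 /=.
  rewrite lnV ?posrE// (_ : _ * - _ = - ln (9 * r)).
    by rewrite expRN lnK// posrE; lra.
  by rewrite /s; field; rewrite gt_eqF.
have diamE w : (ediam (word_inv q w @^-1` K) <= (D * 2^-1 ^+ size w)%:E)%E.
  apply: ediam_le => [|x z Kx Kz]; first by rewrite mulr_ge0 ?exprn_ge0 ?invr_ge0 ?ltW.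
  rewrite exprVn ler_pdivlMr ?exprn_gt0// mulrC -(enorm_word_inv q).
  exact: KD.
have pw (w : seq 'I_3) : (D * 2^-1 ^+ size w) `^ s = D `^ s * a ^+ size w.
  rewrite powRM ?exprn_ge0 ?invr_ge0 ?ltW//; congr (_ * _).
  by rewrite -!powR_mulrn ?invr_ge0 ?ltW// /a -!powRrM mulrC.
have pre delta : 0 < delta -> (hausdorff_premeasure s delta (lim_sup_set E) <= 0)%E.
  move=> d0; apply/lee_addgt0Pr => e e0; rewrite add0e.
  have [|N1 hN1] := @geometric_small D 2^-1 delta _ d0; first lra.
  have [|N2 hN2] := @geometric_small (D `^ s * (1 - t)^-1) t e _ e0.
    by rewrite (ltW t0).
  (* N1 makes the cells smaller than delta, and N2 makes the tail of the series at most e. *)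
  pose m := maxn N1 N2.
  (* Only heavy words of even length at least 2 m are used in the cover; all other words receive the
     empty set. *)
  pose c (w : seq 'I_3) := [&& W w, ~~ odd (size w) & (m <= (size w)./2)%N].
  pose U w := if c w then word_inv q w @^-1` K else set0.
  pose f w := if c w then D `^ s * a ^+ size w else 0.
  have Da n : 0 <= D `^ s * a ^+ n by rewrite mulr_ge0 ?powR_ge0 ?exprn_ge0 ?ltW.
  have f0 w : 0 <= f w by rewrite /f; case: ifP.
  apply: (@hausdorff_premeasure_le_words _ _ _ _ U f _ s0 (ltW d0)).
  - move=> w; rewrite /U; case: ifP => [/and3P[_ _ mw]|_]; last first.
      by rewrite ediam_set0 lee_fin ltW.
    apply: (le_trans (diamE w)); rewrite lee_fin; apply: hN1.
    apply: (leq_trans (leq_maxl N1 N2)); apply: (leq_trans mw).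
    by rewrite -divn2 leq_div.
  - move=> w; rewrite /U /f; case: ifP => _; last first.
      by rewrite ediam_set0 poweR0r// gt_eqF.
    have fd : ediam (word_inv q w @^-1` K) \is a fin_num.
      by rewrite ge0_fin_numE ?ediam_ge0// (le_lt_trans (diamE w))// ltry.
    rewrite -[in leLHS](fineK fd) poweR_EFin lee_fin -pw.
    apply: ge0_ler_powR; first exact: ltW.
    + by rewrite nnegrE fine_ge0// ediam_ge0.
    + by rewrite nnegrE mulr_ge0 ?exprn_ge0 ?invr_ge0// ltW.
    + by rewrite -lee_fin fineK.
  - move=> z /(_ m I)[j /= mj [w [wj Ww] Kw]]; exists w => //.
    by rewrite /U /c Ww (size_words wj) odd_double doubleK mj.
  - move=> M; pose g n := \sum_(w <- words n) f w.
    apply: (@le_trans _ _ (\sum_(n < M) g n.*2)).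
      apply: (@sum_even_le g M) => [n|n on]; first exact: sumr_ge0.
      rewrite /g big_seq big1// => w /size_words wn.
      by rewrite /f /c wn on andbF.
    (* Since r = t^2, for n >= m one has r^n <= t^m t^n: one factor makes the tail small, the other
       sums to at most 1 / (1 - t). *)
    apply: (@le_trans _ _ (\sum_(n < M) D `^ s * t ^+ m * t ^+ n)).
      apply: ler_sum => n _.
      have [mn|nm] := leqP m n; last first.
        rewrite /g big_seq big1; first by rewrite !mulr_ge0 ?powR_ge0 ?exprn_ge0 ?ltW.
        by move=> w /size_words wn; rewrite /f /c wn doubleK leqNgt nm !andbF.
      have gE : g n.*2 = D `^ s * r^-1 ^+ n *
          \sum_(w <- words n.*2 | W w) bernoulli_weight p w.
        rewrite /g mulr_sumr [RHS]big_mkcond big_seq [RHS]big_seq.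
        apply: eq_bigr => w /size_words wn.
        rewrite /f /c wn odd_double doubleK mn /= andbT; case: ifP => // _.
        rewrite bernoulli_weight_const wn -!mul2n !exprM a2 -!mulrA; congr (_ * _).
        rewrite -exprMn; congr (_ ^+ _); field; rewrite gt_eqF//.
      rewrite gE -!mulrA; apply: ler_wpM2l; first exact: powR_ge0.
      apply: (@le_trans _ _ (r^-1 ^+ n * kappa R ^+ n)).
        apply: ler_wpM2l; first by rewrite exprn_ge0// invr_ge0 ltW.
        exact: (heavy_bernoulli_le p0 p1 cy n).
      rewrite -exprMn -r2 expr2 mulKf ?gt_eqF// -t2 expr2 exprMn.
      apply: ler_wpM2r; first by rewrite exprn_ge0// ltW.
      by apply: ler_wiXn2l => //; exact: ltW.
    rewrite -mulr_sumr; apply: le_trans (hN2 m (leq_maxr _ _)).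
    rewrite [leLHS]mulrAC; apply: ler_wpM2r; first by rewrite exprn_ge0// ltW.
    apply: ler_wpM2l; first exact: powR_ge0.
    by have := geometric_sum_le t0 t1 M; rewrite big_mkord.
apply/eqP; rewrite eq_le; apply/andP; split.
  by apply: ge_ereal_sup => _ [delta d0 <-]; exact: pre.
apply: (@le_trans _ _ (hausdorff_premeasure s 1 (lim_sup_set E))).
  apply: le_ereal_inf_tmp => _ [U [_ _ ->]].
  by apply: nneseries_ge0 => k _ _; exact: poweR_ge0.
by apply: ereal_sup_ubound; exists 1 => //; exact: ltr01.
Qed.

End DimensionUpperBound.

Unset Implicit Arguments.

Theorem proposition3p7 (R : realType) (q : 'I_3 -> 'cV[R]_2)
    (K : set (plane R)) (mu : 'cV[R]_2 -> probability (plane R) R)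
    (hq : equilateral q)
    (hK : attractor (gasket_map q) K)
    (hmu : gasket_family q K mu)
    (y : 'cV[R]_2) (hy : circle y) :
  (0 < measure_dim K (mu y) < (ln 3 / ln 2)%:E)%E /\
  (forall (p : 'I_3 -> R) (nu : probability (plane R) R),
     (forall i, 0 <= p i) -> \sum_(i < 3) p i = 1 ->
     self_similar q K p nu -> singular (mu y) nu).
Proof.
have [b [L hb]] := equilateral_barycentric hq.
split; first by rewrite (measure_dim_gt0 hb hK hmu)// (measure_dim_lt hK hmu).
move=> p nu p0 p1 hnu.
exact: (gasket_family_singular hb hK hmu hy p0 p1 hnu).
Qed.
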